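(* Let $n\ge 2$, let $\omega_\Sigma:\mathbb{R}\to\mathbb{R}$ be the profile function of an oscillating cylinder $\Sigma$ satisfying the graph condition $\langle \nu_\Sigma(z),e_1\rangle > C_\Sigma\ge 0$ for all $z$, where $C_\Sigma$ is a constant, and let $\omega_0$ be admissible initial data for the Neumann problem (P). Assume that there is no point $z^*$ with $\omega_\Sigma(z^* )=0$, and that at each of the two ends $z\to+\infty$ and $z\to-\infty$ at least one of the following holds: (i) the limit $\lim_{z\to\pm\infty}\omega_\Sigma(z)$ (with the sign of the end considered) does not exist; (ii) there exists $a$ with $|a|>0$ ($a>0$ for the end $+\infty$, $a<0$ for the end $-\infty$) such that $z\,\frac{d\omega_\Sigma}{dz}(z)>0$ for all $z>a$ if $a>0$, respectively for all $z<a$ if $a<0$. Suppose that the initial hypersurface $F_0(D^n)$ generated by $\omega_0$ is contained in a belly region $\Theta(z_1,z_2)$ of $\Sigma$, that it intersects a flat disk in $\Theta(z_1,z_2)$, and that one of the following holds: (a) $H(\cdot,0)<0$ and $\omega_0(r(0))>\alpha$, where $\alpha$ is the $z$-coordinate of the highest minimal disk in $\Theta(z_1,z_2)$; or (b) $H(\cdot,0)>0$ and $\omega_0(r(0))<\beta$, where $\beta$ is the $z$-coordinate of the lowest minimal disk in $\Theta(z_1,z_2)$. Then the global solution $F:D^n\times[0,\infty)\to\mathbb{R}^{n+1}$ of mean curvature flow with free boundary on $\Sigma$ generated by the solution of (P) converges to a flat disk supported at a local minimum of $\omega_\Sigma$ in a shrinking neck region. If $\Theta(z_1,z_2)\subset\Theta(z_{min},z_{max})$,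 where $\Theta(z_{min},z_{max})$ is a maximal belly region and $-\infty<z_{min}<z_{max}<\infty$, then the flat disk supported at $\omega_\Sigma(z_{max})$ is the unique limit of all solutions to (P) with initial data satisfying (a), and the flat disk supported at $\omega_\Sigma(z_{min})$ is the unique limit of all solutions to (P) with initial data satisfying (b).
   Context: Points of $\mathbb{R}^{n+1}$ are written $(x,z)$, $x\in\mathbb{R}^n$, $z\in\mathbb{R}$, and $y=|x|$. $Oz$ is the $z$-axis. Oscillating cylinder: the rotationally symmetric hypersurface $\Sigma=\{(x,z):|x|=\omega_\Sigma(z)\}$ generated by the (smooth) graph of a function $\omega_\Sigma:\mathbb{R}\to\mathbb{R}$ over $Oz$. In the profile plane with coordinates $(y,z)$ its unit normal, pointing away from the interior of the evolving hypersurface, is $\nu_\Sigma=\frac{1}{\sqrt{1+(\omega_\Sigma')^2}}(1,-\omega_\Sigma')$ and $e_1=(1,0)$ is the direction of the $y$-axis. Condition (i) means that there is no finite limit; divergence to infinity counts as non-existence of the limit. Neumann problem (P): find $r(t)>0$, $D(t)=(0,r(t))$, and $\omega:D(t)\times[0,T)\to\mathbb{R}$ such that (1) $\frac{\partial\omega}{\partial t}=\frac{d^2\omega}{dy^2}\frac{1}{1+(d\omega/dy)^2}+\frac{d\omega}{dy}\frac{n-1}{y}$ on $(0,r(t))\times[0,T)$; (2) $r(t)=\omega_\Sigma(\omega(r(t),t))$ and $\langle\nu_\omega,\nu_\Sigma\rangle=0$ at $y=r(t)$, where $\nu_\omega=\frac{1}{\sqrt{1+(d\omega/dy)^2}}\left(-\frac{d\omega}{dy},1\right)$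 (equivalently $\frac{d\omega}{dy}(r(t),t)=-\frac{d\omega_\Sigma}{dz}(\omega(r(t),t))$); (3) $\lim_{y\to0}\frac1y\frac{d\omega}{dy}(y,t)$ exists; (4) $\omega(y,0)=\omega_0(y)$ on $(0,r(0))$. Admissible initial data: $\omega_0:(0,r(0))\to\mathbb{R}$, $\omega_0\in C^2((0,r(0)))$, generating the initial graph, with $r(0)=\omega_\Sigma(\omega_0(r(0)))$ and $\langle\nu_{\omega_0},\nu_\Sigma\rangle=0$ at $r(0)$. Mean curvature flow with free boundary on $\Sigma$: $\frac{\partial F}{\partial t}=-H\nu$ on $D^n\times[0,T)$, $\langle\nu,\nu_\Sigma\rangle=0$ and $F(\partial D^n,t)\subset\Sigma$ on the boundary, $F(\cdot,0)=F_0$. A solution $\omega$ of (P) generates such a flow by $F(x,t)=(x,\omega(|x|,t))$ (up to reparametrisation). The sign convention is $\nu=\nu_\omega$ (upward), so for the graph of $u(x)=\omega(|x|)$ one has $H=-\mathrm{div}\left(\frac{Du}{\sqrt{1+|Du|^2}}\right)$ and $\frac{\partial\omega}{\partial t}=-H\sqrt{1+(d\omega/dy)^2}$; $H(\cdot,0)$ is the mean curvature of the initial hypersurface. Under the stated hypotheses a global smooth solution (defined for all $t\in[0,\infty)$) exists. Regions: for $z_1,z_2\in[-\infty,\infty]$, $\Theta(z_1,z_2)=\{(x,z):|x|<\omega_\Sigma(z),\ z\in(z_1,z_2)\}$. It is a shrinking neck region (respectively a belly region) if for all $z\in(z_1,z_2)$, $\frac{d\omega_\Sigma}{dz}(z)=0$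 implies that $\omega_\Sigma(z)$ is a weak local minimum (respectively maximum) value for $\omega_\Sigma$. A maximal belly region is a belly region not properly contained in another belly region. A hypersurface with boundary on $\Sigma$ is contained in $\Theta(z_1,z_2)$ if all its points $(x,z)$, boundary points included, satisfy $|x|\le\omega_\Sigma(z)$ and $z\in(z_1,z_2)$. The flat (minimal) disks in $\Theta(z_1,z_2)$ are the disks $\{(x,z^* ):|x|\le\omega_\Sigma(z^* )\}$ with $z^*\in(z_1,z_2)$, $\frac{d\omega_\Sigma}{dz}(z^* )=0$; such a disk is said to be supported at $z^*$ (or at $\omega_\Sigma(z^* )$). Highest/lowest refers to the $z$-coordinate.
   Formalization: That the limit disk is supported at a local minimum in a shrinking neck region is asserted only if every critical point of the profile lies in a neck or belly region; otherwise a horizontal inflection point can support the limit disk. Convergence and the second part need no such assumption. *)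

(* Defs.v *)
From HB Require Import structures.
From mathcomp Require Import all_boot all_order all_algebra.
From mathcomp Require Import all_classical all_reals all_analysis.
Set Implicit Arguments.
Unset Strict Implicit.
Unset Printing Implicit Defensive.
Import Order.TTheory GRing.Theory Num.Theory.
Import numFieldNormedType.Exports.
Local Open Scope classical_set_scope.
Local Open Scope ring_scope.

(* Points of R^(n+1) are pairs (x, z) with x : 'rV[R]_n and z : R.  Points of
   the profile plane are pairs (y, z) : R * R.

   Convention for functions on a closed set: profiles are total functions, and
   a function living on a closed set is represented by any extension of it.
   Derivatives at an edge point are those of the extension; they agree with
   the one-sided derivatives of the restriction. *)

Section Geometry.
Variable R : realType.

(* The library norm on 'rV[R]_n is the sup norm, hence this definition. *)
Definition enorm n (x : 'rV[R]_n) : R := Num.sqrt (\sum_i x ord0 i ^+ 2).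

Definition edist n (p q : 'rV[R]_n * R) : R :=
  Num.sqrt (enorm (p.1 - q.1) ^+ 2 + (p.2 - q.2) ^+ 2).

Definition dot2 (a b : R * R) : R := a.1 * b.1 + a.2 * b.2.

Definition e1 : R * R := (1, 0).

Definition nuSigma (wS : R -> R) (z : R) : R * R :=
  let c := (Num.sqrt (1 + derive1 wS z ^+ 2))^-1 in (c, - (c * derive1 wS z)).

Definition nu_graph (f : R -> R) (y : R) : R * R :=
  let c := (Num.sqrt (1 + derive1 f y ^+ 2))^-1 in (- (c * derive1 f y), c).

Definition smooth1 (f : R -> R) : Prop :=
  forall k x, derivable (derive1n k f) x 1.

Definition C2_on (A : set R) (f : R -> R) : Prop :=
  forall y, A y ->
    [/\ derivable f y 1, derivable (derive1 f) y 1 &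
        {for y, continuous (derive1 (derive1 f))}].

Definition Dy (w : R -> R -> R) : R -> R -> R :=
  fun y t => derive1 (fun s => w s t) y.
Definition Dt (w : R -> R -> R) : R -> R -> R :=
  fun y t => derive1 (w y) t.

Definition jointly (w : R -> R -> R) : R * R -> R := fun p => w p.1 p.2.

(* w is of class C^k (jointly in both variables) on the open set U. *)
Fixpoint Ck (k : nat) (U : set (R * R)) (w : R -> R -> R) : Prop :=
  (forall p, U p -> {for p, continuous (jointly w)}) /\
  match k with
  | 0%N => True
  | k'.+1 =>
      [/\ forall p, U p -> derivable (fun s => w s p.2) p.1 1 /\
                           derivable (w p.1) p.2 1,
          Ck k' U (Dy w) & Ck k' U (Dt w)]
  end.

Definition dirvec n (i : 'I_n) : 'rV[R]_n := delta_mx ord0 i.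

Definition grad_sq n (u : 'rV[R]_n -> R) (x : 'rV[R]_n) : R :=
  \sum_j ('D_(dirvec j) u x) ^+ 2.

(* H = - div (Du / sqrt (1 + |Du|^2)) *)
Definition graph_mean_curvature n (u : 'rV[R]_n -> R) (x : 'rV[R]_n) : R :=
  - \sum_i 'D_(dirvec i)
      (fun x' => 'D_(dirvec i) u x' / Num.sqrt (1 + grad_sq u x')) x.

Definition mean_curvature n (f : R -> R) : 'rV[R]_n -> R :=
  graph_mean_curvature (fun x : 'rV[R]_n => f (enorm x)).

Definition rot_graph n (f : R -> R) (rho : R) : set ('rV[R]_n * R) :=
  (fun x => (x, f (enorm x))) @` [set x | enorm x <= rho].

End Geometry.

Section Cylinder.
Variables (R : realType) (n : nat) (wS : R -> R).

Definition Theta (z1 z2 : \bar R) : set ('rV[R]_n * R) :=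
  [set p | enorm p.1 < wS p.2 /\ (z1 < p.2%:E < z2)%E].

Definition weak_local_min (z : R) : Prop := \forall z' \near z, wS z <= wS z'.
Definition weak_local_max (z : R) : Prop := \forall z' \near z, wS z' <= wS z.

Definition neck_region (z1 z2 : \bar R) : Prop :=
  forall z, (z1 < z%:E < z2)%E -> derive1 wS z = 0 -> weak_local_min z.
Definition belly_region (z1 z2 : \bar R) : Prop :=
  forall z, (z1 < z%:E < z2)%E -> derive1 wS z = 0 -> weak_local_max z.

Definition maximal_belly_region (z1 z2 : \bar R) : Prop :=
  belly_region z1 z2 /\
  forall a b, belly_region a b -> ~ (Theta z1 z2 `<` Theta a b).

Definition contained_in (M : set ('rV[R]_n * R)) (z1 z2 : \bar R) : Prop :=
  forall p, M p -> enorm p.1 <= wS p.2 /\ (z1 < p.2%:E < z2)%E.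

Definition disk (z : R) : set ('rV[R]_n * R) :=
  [set p | enorm p.1 <= wS z /\ p.2 = z].

Definition supports_flat_disk (z1 z2 : \bar R) (z : R) : Prop :=
  (z1 < z%:E < z2)%E /\ derive1 wS z = 0.

Definition highest_flat_disk (z1 z2 : \bar R) (a : R) : Prop :=
  supports_flat_disk z1 z2 a /\
  forall z, supports_flat_disk z1 z2 z -> z <= a.
Definition lowest_flat_disk (z1 z2 : \bar R) (b : R) : Prop :=
  supports_flat_disk z1 z2 b /\
  forall z, supports_flat_disk z1 z2 z -> b <= z.

(* Every flat disk lies in a shrinking neck region or in a belly region.  This
   excludes horizontal inflection points of wS (which are neither weak local
   minima nor weak local maxima) and accumulations of mixed critical points.
   Without it a limit disk need not be supported at a local minimum: for
   wS' z = - c z (z - 1)^2 (4 - z^2), c > 0, the disk at the inflection point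
   z = 1 attracts the solutions starting between z = 0 and z = 1 with H < 0. *)
Definition made_of_necks_and_bellies : Prop :=
  forall z, derive1 wS z = 0 ->
    exists a b : \bar R,
      (a < z%:E < b)%E /\ (neck_region a b \/ belly_region a b).

Definition end_condition_pinfty : Prop :=
  ~ (exists l : R, wS z @[z --> +oo] --> l) \/
  (exists2 a : R, 0 < a & forall z, a < z -> 0 < z * derive1 wS z).
Definition end_condition_ninfty : Prop :=
  ~ (exists l : R, wS z @[z --> -oo] --> l) \/
  (exists2 a : R, a < 0 & forall z, z < a -> 0 < z * derive1 wS z).

Record admissible (r0 : R) (w0 : R -> R) : Prop := Admissible {
  adm_r0 : 0 < r0;
  adm_C2 : C2_on [set y | 0 < y < r0] w0;
  adm_cont : {within [set y | 0 <= y <= r0], continuous w0};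
  adm_diff : derivable w0 r0 1;
  adm_boundary : r0 = wS (w0 r0);
  adm_neumann : dot2 (nu_graph w0 r0) (nuSigma wS (w0 r0)) = 0 }.

Definition space_time (r : R -> R) : set (R * R) :=
  [set p | 0 <= p.2 /\ 0 <= p.1 <= r p.2].

(* Global smooth solutions (r, w) of the Neumann problem, w y t being the height
   over radius y at time t.  The solution is C^infinity for t > 0, up to the
   axis and up to the free boundary; at t = 0, where the data are only C^2,
   what is asked is continuity of the derivatives occurring in the equation. *)
Record global_solution (r0 : R) (w0 : R -> R)
    (r : R -> R) (w : R -> R -> R) : Prop := GlobalSolution {
  sol_r_gt0 : forall t, 0 <= t -> 0 < r t;
  sol_r_cont : {within [set t | 0 <= t], continuous r};
  sol_r_smooth : forall k t, 0 < t -> derivable (derive1n k r) t 1;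
  sol_smooth : exists U : set (R * R),
    [/\ open U, space_time r `&` [set p | 0 < p.2] `<=` U &
        forall k, Ck k U w];
  sol_derivable : forall y t, space_time r (y, t) ->
    [/\ derivable (fun s => w s t) y 1,
        derivable (fun s => Dy w s t) y 1 & derivable (w y) t 1];
  sol_cont :
    [/\ {within space_time r, continuous (jointly w)},
        {within space_time r, continuous (jointly (Dy w))},
        {within space_time r, continuous (jointly (Dy (Dy w)))} &
        {within space_time r, continuous (jointly (Dt w))}];
  sol_pde : forall y t, 0 <= t -> 0 < y < r t ->
    Dt w y t = Dy (Dy w) y t * (1 / (1 + Dy w y t ^+ 2))
               + Dy w y t * ((n%:R - 1) / y);
  sol_boundary : forall t, 0 <= t -> r t = wS (w (r t) t);
  sol_neumann : forall t, 0 <= t ->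
    dot2 (nu_graph (fun y => w y t) (r t)) (nuSigma wS (w (r t) t)) = 0;
  sol_axis : forall t, 0 <= t ->
    exists l : R, y^-1 * Dy w y t @[y --> 0^'+] --> l;
  sol_r_init : r 0 = r0;
  sol_init : forall y, 0 < y < r0 -> w y 0 = w0 y }.

(* The hypersurface F(D^n, t), F(x, t) = (x, w |x| t). *)
Definition flow_at (r : R -> R) (w : R -> R -> R) (t : R)
  : set ('rV[R]_n * R) := rot_graph (fun y => w y t) (r t).

(* Hausdorff convergence as t -> +oo; it does not see reparametrisations, and
   for these graphs it amounts to r t -> wS z together with uniform convergence
   of w(., t) to z. *)
Definition converges_to (M : R -> set ('rV[R]_n * R))
    (L : set ('rV[R]_n * R)) : Prop :=
  forall e : R, 0 < e -> \forall t \near +oo,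
    (forall p, M t p -> exists2 q, L q & edist p q < e) /\
    (forall q, L q -> exists2 p, M t p & edist p q < e).

Record initial_hypersurface (z1 z2 : \bar R) (r0 : R) (w0 : R -> R) : Prop :=
  InitialHypersurface {
  init_admissible : admissible r0 w0;
  init_contained : contained_in (rot_graph w0 r0) z1 z2;
  init_meets_disk : exists2 z, supports_flat_disk z1 z2 z &
    rot_graph w0 r0 `&` disk z !=set0 }.

(* w0 is C^2 on the open interval (0, r0) only, so the sign of H is prescribed
   over 0 < |x| < r0. *)
Definition condition_a (z1 z2 : \bar R) (r0 : R) (w0 : R -> R) : Prop :=
  (forall x : 'rV[R]_n, 0 < enorm x < r0 -> mean_curvature w0 x < 0) /\
  (exists2 alpha, highest_flat_disk z1 z2 alpha & alpha < w0 r0).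
Definition condition_b (z1 z2 : \bar R) (r0 : R) (w0 : R -> R) : Prop :=
  (forall x : 'rV[R]_n, 0 < enorm x < r0 -> 0 < mean_curvature w0 x) /\
  (exists2 beta, lowest_flat_disk z1 z2 beta & w0 r0 < beta).

(* The disk at z is a flat disk, and the only one to which M converges. *)
Definition unique_limit_disk (M : R -> set ('rV[R]_n * R)) (z : R) : Prop :=
  [/\ derive1 wS z = 0, converges_to M (disk z) &
      forall z', derive1 wS z' = 0 -> converges_to M (disk z') -> z' = z].

End Cylinder.

Arguments Theta {R} n wS z1 z2.
Arguments disk {R} n wS z.
Arguments flow_at {R} n r w t.
Arguments unique_limit_disk {R} n wS M z.

(* Main.v *)
(* The whole argument is a chain of maximum principles on the moving interval
   (0, r(t)), all instances of [min_principle].  Case (b) is case (a) for the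
   flow reflected in z = 0, so let H(., 0) < 0.

   The velocity v = w_t solves the linearised equation with a Robin condition
   v_y = c(t) v at y = r(t); a barrier eps * exp(K t + lam y^2) gives v >= 0 for
   all times.  By the equation v >= 0 forces w_y >= 0, hence wS' = - w_y <= 0 at
   the boundary height b(t) = w(r(t), t), which is nondecreasing since
   b' = v / (1 + w_y^2).  Let c be the first critical height of wS above b(0); it
   exists because wS cannot decrease up to +oo.  The disk at height c is
   stationary, and an exponential barrier shows b(t) < c for all t.  If b stayed
   below some c' < c, the boundary slope would be bounded below and a rising
   paraboloid k y^2 + k (n-1) t could be kept below w, which is bounded:
   therefore b(t) -> c.  The same paraboloid, now controlled at the boundary by
   its height, lifts w(0, t) up to c, and w(0, t) <= w(y, t) <= b(t) < c.

   As wS' < 0 on [b(0), c), the height c is not a weak local maximum.  So it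
   lies in no belly region, which places c in a neck region, respectively at
   the end zmax of a maximal belly region. *)
From HB Require Import structures.
Require Import Defs.
From mathcomp Require Import all_boot all_order all_algebra.
From mathcomp Require Import all_classical all_reals all_analysis.
From mathcomp Require Import ring lra.
Set Implicit Arguments.
Unset Strict Implicit.
Unset Printing Implicit Defensive.
Import Order.TTheory GRing.Theory Num.Theory.
Import numFieldNormedType.Exports.
Local Open Scope classical_set_scope.
Local Open Scope ring_scope.
(** * Calculus of one and two variables *)

Section Calculus.
Variable R : realType.
Implicit Types (f df g : R -> R) (a b d e x y t : R).

Lemma derivable_is_derive f x : derivable f x 1 -> is_derive x 1 f (derive1 f x).
Proof. by move=> fx; rewrite derive1E; exact/derivableP. Qed.

Lemma is_derive1_derive1 f x d : is_derive x 1 f d -> derive1 f x = d.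
Proof. by move=> fx; rewrite derive1E derive_val. Qed.

Lemma is_derive1_continuous f x d : is_derive x 1 f d -> {for x, continuous f}.
Proof. by move=> [fx _]; apply/differentiable_continuous/derivable1_diffP. Qed.

Lemma is_derive1P f x d : is_derive x 1 f d <->
  forall e, 0 < e -> exists2 del, 0 < del &
    forall h, `|h| < del -> `|f (x + h) - f x - d * h| <= e * `|h|.
Proof.
split=> [fx e e0|fx].
  have [fxd fxE] := fx.
  have : h^-1 *: (f (h *: 1 + x) - f x) @[h --> 0^'] --> d.
    by rewrite -fxE; exact: fxd.
  move/cvgrPdist_lt => /(_ e e0) [del /= del0 H].
  exists del => // h hd; have [->|h0] := eqVneq h 0.
    by rewrite addr0 subrr mulr0 subr0 normr0 mulr0.
  have := H h; rewrite /ball_/= sub0r normrN => /(_ hd h0).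
  rewrite [h *: 1]mulr1 [h + x]addrC => /ltW; rewrite -ler_pdivrMr ?normr_gt0//; apply: le_trans.
  rewrite ler_pdivrMr ?normr_gt0// -normrM.
  rewrite le_eqVlt; apply/orP; left; apply/eqP; rewrite -normrN.
  by congr `|_|; rewrite /GRing.scale/=; field.
have cv : h^-1 *: (f (h *: 1 + x) - f x) @[h --> 0^'] --> d.
  apply/cvgrPdist_le => e e0; have [del del0 H] := fx e e0.
  exists del => // h /=; rewrite sub0r normrN => hd h0.
  have := H h hd; rewrite -ler_pdivrMr ?normr_gt0//; apply: le_trans.
  rewrite ler_pdivlMr ?normr_gt0// -normrM.
  rewrite le_eqVlt; apply/orP; left; apply/eqP; rewrite -normrN.
  by congr `|_|; rewrite [h *: 1]mulr1 [h + x]addrC /GRing.scale/=; field.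
have fxd : derivable f x 1 by apply/cvg_ex; exists d.
by apply: DeriveDef => //; exact: cvg_lim cv.
Qed.

Lemma mvt f df a b : a < b ->
  (forall x, a <= x <= b -> is_derive x 1 f (df x)) ->
  exists2 c, a < c < b & f b - f a = df c * (b - a).
Proof.
move=> ab fd; have [||c] := @MVT R f df a b ab.
- by move=> x; rewrite in_itv/= => /andP[ax xb]; apply: fd; rewrite !ltW.
- apply: continuous_in_subspaceT => x; rewrite inE/= in_itv/= => xab.
  exact: is_derive1_continuous (fd x xab).
- by rewrite in_itv/= => cab ->; exists c.
Qed.

(** Covers both orders of [a] and [b]: in the chain rule below the sign of the increment of [g] is
    unknown. *)
Lemma mvt_norm f df a b :
  (forall x, `|x - a| <= `|b - a| -> is_derive x 1 f (df x)) ->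
  exists2 c, `|c - a| <= `|b - a| & f b - f a = df c * (b - a).
Proof.
move=> fd; have [ab|ba|<-] := ltgtP a b.
- have [|c /andP[ac cb] ->] := @mvt f df a b ab.
    move=> x /andP[ax xb]; apply: fd.
    by rewrite !ger0_norm ?subr_ge0 ?(ltW ab)// lerD2r.
  exists c => //; rewrite !ger0_norm ?subr_ge0 ?ltW//.
  by rewrite ltrD2r.
- have [|c /andP[bc ca] E] := @mvt f df b a ba.
    move=> x /andP[bx xa]; apply: fd.
    by rewrite !ler0_norm ?subr_le0 ?(ltW ba)// lerN2 lerD2r.
  exists c; first by rewrite !ler0_norm ?subr_le0 ?(ltW ba) ?(ltW ca)// lerN2 lerD2r ltW.
  by rewrite -[LHS]opprB E -mulrN opprB.
- by exists a; rewrite ?subrr ?normr0// mulr0.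
Qed.

Lemma derive_ge0_right f x d e : is_derive x 1 f d -> 0 < e ->
  (forall s, x < s < x + e -> f x <= f s) -> 0 <= d.
Proof.
move=> /is_derive1P fx e0 H; rewrite leNgt; apply/negP => d0.
(* A tolerance of half the slope gives [f (x + h) - f x <= d * h / 2 < 0]. *)
have [|del del0 K] := fx (- d / 2); first by lra.
pose h := Num.min del e / 2.
have h0 : 0 < h by rewrite divr_gt0// lt_min del0.
have hd : h < del by rewrite ltr_pdivrMr// gt_min; apply/orP; left; lra.
have he : h < e by rewrite ltr_pdivrMr// gt_min; apply/orP; right; lra.
have := K h; rewrite gtr0_norm// => /(_ hd); rewrite ler_norml => /andP[_].
have : f x <= f (x + h) by apply: H; lra.
have : d * h < 0 by rewrite pmulr_llt0.
lra.
Qed.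

Lemma is_derive_reflect f x d : is_derive (- x) 1 f d ->
  is_derive x 1 (fun y => f (- y)) (- d).
Proof.
move=> fx; rewrite -mulrN1.
exact: (@is_derive1_comp R f -%R x d (- 1)).
Qed.

Lemma derive_le0_left f x d e : is_derive x 1 f d -> 0 < e ->
  (forall s, x - e < s < x -> f x <= f s) -> d <= 0.
Proof.
move=> fx e0 H; rewrite -oppr_ge0.
have fNx : is_derive (- - x) 1 f d by rewrite opprK.
apply: (derive_ge0_right (is_derive_reflect fNx) e0) => s /andP[xs se].
by rewrite opprK; apply: H; lra.
Qed.

(** If [d < 0], then [df] is negative just to the right of [x] and [f] drops there. One-sided,
    because at the axis [y = 0] only larger radii belong to the domain. *)
Lemma derive2_ge0_right f df x d e : 0 < e ->
  (forall s, x <= s < x + e -> is_derive s 1 f (df s)) ->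
  df x = 0 -> is_derive x 1 df d ->
  (forall s, x < s < x + e -> f x <= f s) -> 0 <= d.
Proof.
move=> e0 fd dfx0 /is_derive1P dfx H; rewrite leNgt; apply/negP => d0.
have [|del del0 K] := dfx (- d / 2); first by lra.
pose h := Num.min del e / 2.
have h0 : 0 < h by rewrite divr_gt0// lt_min del0.
have hd : h < del by rewrite ltr_pdivrMr// gt_min; apply/orP; left; lra.
have he : h < e by rewrite ltr_pdivrMr// gt_min; apply/orP; right; lra.
have [||c /andP[xc ch] E] := @mvt f df x (x + h).
- lra.
- by move=> s /andP[xs sh]; apply: fd; lra.
have := K (c - x); rewrite gtr0_norm ?subr_gt0// [x + _]addrC subrK dfx0 subr0.
have cd : c - x < del by lra.
move=> /(_ cd); rewrite ler_norml => /andP[_].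
have dc : d * (c - x) < 0 by rewrite pmulr_llt0// subr_gt0.
move=> L; have dfc : df c < 0 by lra.
have : f x <= f (x + h) by apply: H; lra.
rewrite -subr_ge0 E [x + h]addrC addrK pmulr_lge0//; lra.
Qed.

Definition cts2 (F : R -> R -> R) a b := forall e, 0 < e ->
  exists2 del, 0 < del & forall y t,
    `|y - a| < del -> `|t - b| < del -> `|F y t - F a b| < e.

Lemma cts2P (F : R -> R -> R) a b :
  {for (a, b), continuous (jointly F)} -> cts2 F a b.
Proof.
move=> /cvgrPdist_lt H e e0.
have /nbhs_ballP[del /= del0 K] := H e e0; exists del => // y t ya tb; rewrite distrC.
by apply: (K (y, t)); split; rewrite /= /ball/= distrC.
Qed.

Lemma open2P (U : set (R * R)) a b : open U -> U (a, b) ->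
  exists2 del, 0 < del & forall y t,
    `|y - a| < del -> `|t - b| < del -> U (y, t).
Proof.
move=> oU Uab; have /nbhs_ballP[del del0 K] := open_nbhs_nbhs (conj oU Uab).
exists del => // y t ya tb.
by apply: K; split; rewrite /= /ball/= distrC.
Qed.

(** The increment is taken in y at the time [t + h], by the mean value theorem, and then in time at
    the fixed point [g t]. Hence joint continuity is asked of [Fy] only. *)
Lemma is_derive_along (F Fy : R -> R -> R) g t dg Ft del : 0 < del ->
  (forall y s, `|y - g t| < del -> `|s - t| < del ->
     is_derive y 1 (F^~ s) (Fy y s)) ->
  cts2 Fy (g t) t -> is_derive t 1 (F (g t)) Ft -> is_derive t 1 g dg ->
  is_derive t 1 (fun s => F (g s) s) (Fy (g t) t * dg + Ft).
Proof.
move=> del0 FyP Fyc dF dgt; have gc := is_derive1_continuous dgt.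
apply/is_derive1P => e e0.
(* [M] bounds the difference quotients of [g] (its 1 is the tolerance that yields [d4]) and [N]
   bounds [Fy] at the point; the tolerances make each of the three error terms at most [e / 3] times
   the size of [h]. *)
pose M := `|dg| + 1; have M0 : 0 < M by rewrite ltr_wpDl.
pose N := `|Fy (g t) t| + 1; have N0 : 0 < N by rewrite ltr_wpDl.
have [|d1 d10 H1] := Fyc (e / (3 * M)); first by rewrite divr_gt0// mulr_gt0.
have [|d2 d20 H2] := (is_derive1P _ _ _).1 dF (e / 3); first by rewrite divr_gt0.
have [|d3 d30 H3] := (is_derive1P _ _ _).1 dgt (e / (3 * N)).
  by rewrite divr_gt0// mulr_gt0.
have [|d4 d40 H4] := (is_derive1P _ _ _).1 dgt 1; first by [].
have mn0 : 0 < Num.min d1 del by rewrite lt_min d10.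
have := gc => /cvgrPdist_lt /(_ _ mn0) [d5 /= d50 H5].
exists (Num.min d1 (Num.min d2 (Num.min d3 (Num.min d4 (Num.min d5 del))))).
  by rewrite !lt_min d10 d20 d30 d40 d50.
move=> h; rewrite !lt_min => /and5P[hd1 hd2 hd3 hd4 /andP[hd5 hdel]].
have := H5 (t + h); rewrite /ball_/= opprD addrA subrr sub0r normrN => /(_ hd5).
rewrite distrC lt_min => /andP[gd1 gdel].
have thd : `|t + h - t| < del by rewrite addrAC subrr add0r.
have thd1 : `|t + h - t| < d1 by rewrite addrAC subrr add0r.
have [|c cg Ec] := @mvt_norm (F^~ (t + h)) (Fy^~ (t + h)) (g t) (g (t + h)).
  by move=> x xg; apply: FyP => //; exact: le_lt_trans xg gdel.
have A1 := H1 c _ (le_lt_trans cg gd1) thd1.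
have A2 := H2 h hd2.
have A3 := H3 h hd3.
have A4 : `|g (t + h) - g t| <= M * `|h|.
  have := H4 h hd4; rewrite mul1r => A4.
  have := ler_normD (g (t + h) - g t - dg * h) (dg * h); rewrite subrK normrM.
  by rewrite /M mulrDl mul1r; lra.
have -> : F (g (t + h)) (t + h) - F (g t) t - (Fy (g t) t * dg + Ft) * h =
  (Fy c (t + h) - Fy (g t) t) * (g (t + h) - g t) +
  Fy (g t) t * (g (t + h) - g t - dg * h) +
  (F (g t) (t + h) - F (g t) t - Ft * h).
  have -> : F (g (t + h)) (t + h) =
    Fy c (t + h) * (g (t + h) - g t) + F (g t) (t + h) by rewrite -Ec subrK.
  ring.
have B1 : `|(Fy c (t + h) - Fy (g t) t) * (g (t + h) - g t)| <= e / 3 * `|h|.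
  rewrite normrM (le_trans (ler_pM _ _ (ltW A1) A4))//.
  rewrite mulrA ler_wpM2r// le_eqVlt; apply/orP; left; apply/eqP; field.
  exact: lt0r_neq0.
have B2 : `|Fy (g t) t * (g (t + h) - g t - dg * h)| <= e / 3 * `|h|.
  rewrite normrM; have NN : `|Fy (g t) t| <= N by rewrite /N lerDl.
  rewrite (le_trans (ler_pM _ _ NN A3))// mulrA ler_wpM2r// le_eqVlt.
  by apply/orP; left; apply/eqP; field; exact: lt0r_neq0.
have := ler_normD ((Fy c (t + h) - Fy (g t) t) * (g (t + h) - g t) +
  Fy (g t) t * (g (t + h) - g t - dg * h)) (F (g t) (t + h) - F (g t) t - Ft * h).
have := ler_normD ((Fy c (t + h) - Fy (g t) t) * (g (t + h) - g t))
  (Fy (g t) t * (g (t + h) - g t - dg * h)).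
by move: B1 B2 A2; lra.
Qed.

(* Both mixed partials are limits of the same double difference quotient. *)
Lemma mixed_partials (F Fy Ft Fyt Fty : R -> R -> R) a b del : 0 < del ->
  (forall y t, `|y - a| < del -> `|t - b| < del ->
    [/\ is_derive y 1 (F^~ t) (Fy y t), is_derive t 1 (F y) (Ft y t),
        is_derive t 1 (Fy y) (Fyt y t) & is_derive y 1 (Ft^~ t) (Fty y t)]) ->
  cts2 Fyt a b -> cts2 Fty a b -> Fyt a b = Fty a b.
Proof.
move=> del0 FP c1 c2; apply/eqP; rewrite -subr_eq0 -normr_le0.
apply/ler_addgt0Pr => e e0; rewrite add0r.
have [|d1 d10 H1] := c1 (e / 2); first by rewrite divr_gt0.
have [|d2 d20 H2] := c2 (e / 2); first by rewrite divr_gt0.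
pose h := Num.min d1 (Num.min d2 del) / 2.
have h0 : 0 < h by rewrite divr_gt0// !lt_min d10 d20.
have hd1 : h < d1 by rewrite ltr_pdivrMr// !gt_min; apply/orP; left; lra.
have hd2 : h < d2.
  by rewrite ltr_pdivrMr// !gt_min; apply/or3P; apply: Or32; lra.
have hd : h < del.
  by rewrite ltr_pdivrMr// !gt_min; apply/or3P; apply: Or33; lra.
clearbody h.
have nr x z k : z <= x <= z + h -> h < k -> `|x - z| < k.
  by move=> /andP[zx xh] hk; rewrite ger0_norm ?subr_ge0//; lra.
have za z : z <= z <= z + h by rewrite lexx lerDl ltW.
have zb z : z <= z + h <= z + h by rewrite lexx lerDl ltW.
have lth (z : R) : z < z + h by rewrite ltrDl.
(* [E1] and [E2] evaluate the double difference over a square of side [h] first in y, then in t;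
   [E3] and [E4] do so in the other order. *)
have [|x1 /andP[ax1 x1h] E1] := @mvt (fun y => F y (b + h) - F y b)
    (fun y => Fy y (b + h) - Fy y b) a (a + h) (lth a).
  move=> x xa; apply: is_deriveB.
    by have [] := FP x (b + h) (nr _ _ _ xa hd) (nr _ _ _ (zb b) hd).
  by have [] := FP x b (nr _ _ _ xa hd) (nr _ _ _ (za b) hd).
have x1P : a <= x1 <= a + h by rewrite !ltW.
have [|t1 /andP[bt1 t1h] E2] := @mvt (Fy x1) (Fyt x1) b (b + h) (lth b).
  by move=> t tb; have [] := FP x1 t (nr _ _ _ x1P hd) (nr _ _ _ tb hd).
have [|t2 /andP[bt2 t2h] E3] := @mvt (fun t => F (a + h) t - F a t)
    (fun t => Ft (a + h) t - Ft a t) b (b + h) (lth b).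
  move=> t tb; apply: is_deriveB.
    by have [] := FP (a + h) t (nr _ _ _ (zb a) hd) (nr _ _ _ tb hd).
  by have [] := FP a t (nr _ _ _ (za a) hd) (nr _ _ _ tb hd).
have t2P : b <= t2 <= b + h by rewrite !ltW.
have [|x2 /andP[ax2 x2h] E4] := @mvt (Ft^~ t2) (Fty^~ t2) a (a + h) (lth a).
  by move=> x xa; have [] := FP x t2 (nr _ _ _ xa hd) (nr _ _ _ t2P hd).
have t1P : b <= t1 <= b + h by rewrite !ltW.
have x2P : a <= x2 <= a + h by rewrite !ltW.
have A1 := H1 x1 t1 (nr _ _ _ x1P hd1) (nr _ _ _ t1P hd1).
have A2 := H2 x2 t2 (nr _ _ _ x2P hd2) (nr _ _ _ t2P hd2).
have E : Fyt x1 t1 = Fty x2 t2.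
  have hh : h * h != 0 by rewrite mulf_neq0// gt_eqF.
  apply: (mulIf hh); rewrite /= !mulrA.
  have hE (z : R) : z + h - z = h by rewrite addrAC subrr add0r.
  move: E1 E2 E3 E4; rewrite !hE => E1 E2 E3 E4.
  by rewrite -E2 -E4 -E1 -E3; ring.
have -> : Fyt a b - Fty a b = (Fty x2 t2 - Fty a b) - (Fyt x1 t1 - Fyt a b).
  by rewrite E; ring.
apply: le_trans (ler_normB _ _) _; lra.
Qed.

End Calculus.

(** * The minimum principle on a moving domain *)

Section MovingDomain.
Variable R : realType.
Implicit Types (r : R -> R) (F z : R -> R -> R) (a b e t y : R).

Lemma within1P (A : set R) r : {within A, continuous r} <->
  forall a, A a -> forall e, 0 < e -> exists2 del, 0 < del &
    forall t, A t -> `|t - a| < del -> `|r t - r a| < e.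
Proof.
split=> [/subspace_continuousP rc a Aa e e0|rc].
  have /cvgrPdist_lt /(_ e e0) := rc a Aa.
  rewrite near_withinE => -[del /= del0 H]; exists del => // t At ta.
  by rewrite distrC; apply: H => //=; rewrite distrC.
apply/subspace_continuousP => a Aa; apply/cvgrPdist_lt => e e0.
have [del del0 H] := rc a Aa e e0; rewrite near_withinE.
by exists del => //= t ta At; rewrite distrC; apply: H => //; rewrite distrC.
Qed.

Lemma within2P (A : set (R * R)) F : {within A, continuous (jointly F)} <->
  forall a b, A (a, b) -> forall e, 0 < e -> exists2 del, 0 < del &
    forall y t, A (y, t) -> `|y - a| < del -> `|t - b| < del ->
      `|F y t - F a b| < e.
Proof.
split=> [/subspace_continuousP Fc a b Aab e e0|Fc].
  have /cvgrPdist_lt /(_ e e0) := Fc (a, b) Aab.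
  rewrite near_withinE => /nbhs_ballP[del /= del0 H]; exists del => // y t Ayt ya tb.
  rewrite distrC; apply: (H (y, t)) => //.
  by split; rewrite /= /ball/= distrC.
apply/subspace_continuousP => -[a b] Aab; apply/cvgrPdist_lt => e e0.
have [del del0 H] := Fc a b Aab e e0; rewrite near_withinE.
apply/nbhs_ballP; exists del => // -[y t] [/= ya tb] Ayt; rewrite distrC.
by apply: H => //; rewrite distrC.
Qed.

Definition moving_domain r t0 t1 : set (R * R) :=
  [set p | t0 <= p.2 <= t1 /\ 0 <= p.1 <= r p.2].

(** Reference rectangle: the substitution [y = s * r t] carries it onto the moving domain, so
    compactness arguments can take place on a fixed set. *)
Definition strip (t0 t1 : R) : set (R * R) :=
  [set p | 0 <= p.1 <= 1 /\ t0 <= p.2 <= t1].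

Lemma strip_compact (t0 t1 : R) : compact (strip t0 t1).
Proof.
have -> : strip t0 t1 = `[0, 1]%classic `*` `[t0, t1]%classic.
  by apply/seteqP; split => -[s t]; rewrite /strip/= !in_itv.
by apply: compact_setX; exact: segment_compact.
Qed.

Section FixedTimes.
Variables (r : R -> R) (t0 t1 : R).
Hypothesis t01 : t0 <= t1.
Hypothesis r_gt0 : forall t, t0 <= t <= t1 -> 0 < r t.
Hypothesis r_cont : {within [set t | t0 <= t <= t1], continuous r}.

Lemma stretched_in_domain s t : 0 <= s <= 1 -> t0 <= t <= t1 ->
  moving_domain r t0 t1 (s * r t, t).
Proof.
move=> /andP[s0 s1] tt; split => //=; have rt := r_gt0 tt.
by rewrite mulr_ge0 ?(ltW rt)//= ler_piMl// ltW.
Qed.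

Lemma stretched_continuous F :
  {within moving_domain r t0 t1, continuous (jointly F)} ->
  {within strip t0 t1, continuous (jointly (fun s t => F (s * r t) t))}.
Proof.
move=> /within2P Fc; apply/within2P => s t [/= s01 tt] e e0.
have [d d0 H] := Fc _ _ (stretched_in_domain s01 tt) e e0.
have [|d' d'0 H'] := (within1P _ _).1 r_cont t tt (d / 2); first by rewrite divr_gt0.
have rt := r_gt0 tt.
have d2r : 0 < d / (2 * r t) by rewrite divr_gt0// mulr_gt0.
exists (Num.min (d / (2 * r t)) (Num.min d' d)); first by rewrite !lt_min d2r d'0.
move=> s' t' [/= s'01 tt']; rewrite !lt_min => /and3P[sd _ _] /and3P[_ td' td].
apply: H => //; first exact: stretched_in_domain.
have -> : s' * r t' - s * r t = s' * (r t' - r t) + (s' - s) * r t by ring.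
apply: le_lt_trans (ler_normD _ _) _; rewrite !normrM [`|r t|]gtr0_norm//.
move: sd; rewrite ltr_pdivlMr ?mulr_gt0// => sd.
have := H' t' tt' td'.
have : `|s'| * `|r t' - r t| <= `|r t' - r t|.
  by rewrite ler_piMl// ger0_norm; case/andP: s'01.
lra.
Qed.

(** Extreme value theorem on the strip. The bound is made positive so that it can serve as a factor
    in barrier constants. *)
Lemma bounded_on_domain F :
  {within moving_domain r t0 t1, continuous (jointly F)} ->
  exists2 M, 0 < M & forall y t, t0 <= t <= t1 -> 0 <= y <= r t -> `|F y t| <= M.
Proof.
move=> /stretched_continuous Fc.
have Nc : {within strip t0 t1, continuous (fun p => `|F (p.1 * r p.2) p.2|)}.
  apply: (@within_continuous_comp R _ _ _ _ (fun x : R => `|x|) _ Fc) => x _.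
  exact: (@norm_continuous _ R).
have [|[c d] _ H] := compact_EVT_max _ (@strip_compact t0 t1) Nc.
  by exists (0, t0); split => /=; rewrite !lexx ?ler01.
exists (`|F (c * r d) d| + 1); first by rewrite ltr_wpDl.
move=> y t tt /andP[y0 yr]; have rt := r_gt0 tt.
have := H (y / r t, t); rewrite /= mulfVK ?gt_eqF// => K.
rewrite ler_wpDr// K// inE; split => //=.
by rewrite divr_ge0 ?(ltW rt)//= ler_pdivrMr// mul1r.
Qed.

Lemma radius_lower_bound : exists2 rho, 0 < rho & forall t, t0 <= t <= t1 -> rho <= r t.
Proof.
have rc : {within `[t0, t1], continuous r}.
  apply: continuous_subspaceW r_cont => t /=; by rewrite in_itv.
have [c] := EVT_min t01 rc; rewrite in_itv/= => cc H.
exists (r c); first exact: r_gt0.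
by move=> t tt; apply: H; rewrite in_itv.
Qed.

(* A first zero of [z] in time is a spatial minimum of its time slice. *)
Theorem min_principle z zy zyy zt :
  {within moving_domain r t0 t1, continuous (jointly z)} ->
  (forall y, 0 <= y <= r t0 -> 0 < z y t0) ->
  (forall y t, t0 < t <= t1 -> 0 <= y <= r t ->
    [/\ is_derive y 1 (z^~ t) (zy y t), is_derive y 1 (zy^~ t) (zyy y t) &
        is_derive t 1 (z y) (zt y t)]) ->
  (forall t, t0 < t <= t1 -> zy 0 t = 0) ->
  (forall t, t0 < t <= t1 -> z (r t) t = 0 -> 0 < zy (r t) t) ->
  (forall y t, t0 < t <= t1 -> 0 <= y < r t ->
    z y t = 0 -> zy y t = 0 -> 0 <= zyy y t -> 0 < zt y t) ->
  forall y t, t0 <= t <= t1 -> 0 <= y <= r t -> 0 < z y t.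
Proof.
move=> zc z_init zD zy0 z_bdry z_int y t tt yt; rewrite ltNge; apply/negP => zyt.
pose Z s t := z (s * r t) t.
have Zc : {within strip t0 t1, continuous (jointly Z)} := stretched_continuous zc.
have inS u v : t0 <= v <= t1 -> 0 <= u <= r v ->
    exists2 s, 0 <= s <= 1 & u = s * r v.
  move=> vv /andP[u0 ur]; have rv := r_gt0 vv; exists (u / r v).
    by rewrite divr_ge0 ?(ltW rv)//= ler_pdivrMr// mul1r.
  by rewrite mulfVK// gt_eqF.
(* In stretched coordinates the set of nonpositivity is compact; a point of it with least time [u]
   is the first zero. *)
pose K := strip t0 t1 `&` [set p | jointly Z p <= 0].
have cK : compact K.
  have cle : closed [set x : R | x <= 0] by exact: closed_le.
  have := (continuous_closedP _).1 Zc _ cle.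
  move=> /closed_subspaceP[V cV VE]; rewrite /K setIC -VE setIC.
  by apply: compact_closedI => //; exact: strip_compact.
have K0 : K !=set0.
  have [s s01 E] := inS y t tt yt; exists (s, t); split; first by split.
  by rewrite /= /jointly/Z/= -E.
have cs : {within K, continuous (fun p : R * R => p.2)}.
  by apply: continuous_subspaceT => p; exact: cvg_snd.
have [[s1 u]] := compact_EVT_min K0 cK cs.
rewrite inE => -[[/= s101 uu] Zle] Kmin.
have before s v : 0 <= s <= 1 -> t0 <= v < u -> 0 < Z s v.
  move=> s01 /andP[v0 vu]; rewrite ltNge; apply/negP => Zsv.
  have : (s, v) \in K.
    rewrite inE; split => //; split => //=; rewrite v0/=.
    by case/andP: uu => _; apply: le_trans; exact: ltW.
  by move/Kmin => /=; rewrite leNgt vu.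
have t0u : t0 < u.
  rewrite lt_neqAle; case/andP: uu => -> _; rewrite andbT; apply/negP => /eqP tu.
  move: Zle; rewrite /= /jointly/Z/= leNgt => /negP; apply; rewrite -tu.
  apply: z_init; have t0t : t0 <= t0 <= t1 by rewrite lexx.
  by have [_] := stretched_in_domain s101 t0t.
have uT : t0 < u <= t1 by rewrite t0u; case/andP: uu.
(* Positivity before [u] becomes nonnegativity at [u] by continuity, tested at a time [v] slightly
   earlier but not before [t0]. *)
have slice s : 0 <= s <= 1 -> 0 <= Z s u.
  move=> s01; rewrite leNgt; apply/negP => Zneg.
  have [||d d0 H] := (within2P _ _).1 Zc s u _ (- Z s u); first by split.
    by rewrite oppr_gt0.
  pose v := Num.max t0 (u - d / 2).
  have v0 : t0 <= v by rewrite le_max lexx.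
  have vu : v < u by rewrite gt_max t0u/=; lra.
  have vud : u - d / 2 <= v by rewrite le_max lexx orbT.
  have vS : strip t0 t1 (s, v) by split => //=; rewrite v0 (le_trans (ltW vu))//; case/andP: uu.
  have := H s v vS; rewrite subrr normr0 => /(_ d0).
  have -> : `|v - u| < d by rewrite ltr0_norm ?subr_lt0//; lra.
  move=> /(_ isT); rewrite ltr_norml => /andP[_].
  have : 0 < Z s v by apply: before => //; rewrite v0.
  lra.
pose x := s1 * r u.
have ru : 0 < r u by exact: r_gt0.
have [_ /= /andP[x0 xr]] := stretched_in_domain s101 uu.
rewrite -/x in x0 xr.
have zx : z x u = 0.
  by apply/eqP; rewrite eq_le; apply/andP; split => //; exact: slice.
have zge s : 0 <= s <= r u -> z x u <= z s u.
  by move=> su; rewrite zx; have [s' s'01 ->] := inS _ _ uu su; exact: slice.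
have [D1 D2 D3] : [/\ is_derive x 1 (z^~ u) (zy x u),
    is_derive x 1 (zy^~ u) (zyy x u) & is_derive u 1 (z x) (zt x u)].
  by apply: zD => //; rewrite x0.
have left_le : 0 < x -> zy x u <= 0.
  move=> xgt0; apply: (derive_le0_left D1 xgt0) => s /andP[s0 sx].
  by apply: zge; rewrite (le_trans (ltW sx) xr) andbT; lra.
(* At the free boundary the slice minimum has [zy <= 0], which [z_bdry] excludes; there remain
   interior points and the axis. *)
move: xr; rewrite le_eqVlt => /orP[/eqP xr|xr].
  have := z_bdry u uT; rewrite -xr => /(_ zx).
  by rewrite ltNge left_le// xr.
have e0 : 0 < r u - x by rewrite subr_gt0.
have ux s : x < s < x + (r u - x) -> 0 <= s <= r u.
  by rewrite [x + _]addrC subrK => /andP[xs sr]; rewrite (ltW sr) (le_trans x0 (ltW xs)).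
have zyx : zy x u = 0.
  move: x0; rewrite le_eqVlt => /orP[/eqP <-|xgt0]; first exact: zy0.
  apply/eqP; rewrite eq_le left_le//=.
  by apply: (derive_ge0_right D1 e0) => s /ux; exact: zge.
have zyyx : 0 <= zyy x u.
  apply: (derive2_ge0_right e0 _ zyx D2) => [s|s /ux]; last exact: zge.
  rewrite [x + _]addrC subrK => /andP[xs sr].
  by have [] := zD s u uT; rewrite ?(le_trans x0 xs) ?(ltW sr).
(* Since [x < r u], the radius [x] also lies in the domain at times just before [u]. There [z x] is
   positive, so its time derivative at [u] is at most 0, against [z_int]. *)
have [|d d0 H] := (within1P _ _).1 r_cont u uu (r u - x); first by [].
have := z_int x u uT; rewrite x0 xr => /(_ isT zx zyx zyyx); rewrite ltNge => /negP; apply.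
have d'0 : 0 < Num.min d (u - t0) by rewrite lt_min d0 subr_gt0.
apply: (derive_le0_left D3 d'0) => v /andP[dv vu].
have [vd vt0] : u - v < d /\ u - v < u - t0.
  by apply/andP; rewrite -lt_min; lra.
have vv : t0 <= v <= t1 by rewrite (le_trans (ltW vu))//; [lra|case/andP: uu].
have := H v vv; rewrite ltr0_norm ?subr_lt0// opprB => /(_ vd).
rewrite ltr_norml => /andP[rv _]; rewrite zx.
have [s s01 ->] : exists2 s, 0 <= s <= 1 & x = s * r v by apply: inS => //; lra.
by apply/ltW/before => //; case/andP: vv => ->.
Qed.

End FixedTimes.
End MovingDomain.

(** * Derivative rules, limits at the axis and the exponential barrier *)

Section DerivativeRules.
Variable R : realType.
Implicit Types (f g : R -> R) (x d k l : R).

Lemma is_deriveD_fun f g x df dg : is_derive x 1 f df -> is_derive x 1 g dg ->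
  is_derive x 1 (fun y => f y + g y) (df + dg).
Proof. exact: is_deriveD. Qed.

Lemma is_deriveB_fun f g x df dg : is_derive x 1 f df -> is_derive x 1 g dg ->
  is_derive x 1 (fun y => f y - g y) (df - dg).
Proof. exact: is_deriveB. Qed.

Lemma is_deriveN_fun f x df : is_derive x 1 f df ->
  is_derive x 1 (fun y => - f y) (- df).
Proof. exact: is_deriveN. Qed.

Lemma is_deriveM_fun f g x df dg : is_derive x 1 f df -> is_derive x 1 g dg ->
  is_derive x 1 (fun y => f y * g y) (df * g x + f x * dg).
Proof.
move=> fx gx; apply: (is_derive_eq (is_deriveM fx gx)).
by rewrite addrC /GRing.scale/= mulrC.
Qed.

Lemma is_deriveMl_fun k f x df : is_derive x 1 f df ->
  is_derive x 1 (fun y => k * f y) (k * df).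
Proof. exact: is_deriveZ. Qed.

Lemma is_deriveV_fun f x df : f x != 0 -> is_derive x 1 f df ->
  is_derive x 1 (fun y => (f y)^-1) (- (f x ^- 2) * df).
Proof. by move=> fx0 fx; exact: (is_deriveV fx0 fx). Qed.

Lemma is_derive_expR_fun f x df : is_derive x 1 f df ->
  is_derive x 1 (fun y => expR (f y)) (expR (f x) * df).
Proof. by move=> fx; exact: (is_derive1_comp (is_derive_expR _) fx). Qed.

Lemma is_derive_affine k l x : is_derive x 1 (fun y => k * y + l) k.
Proof.
rewrite -[X in is_derive _ _ _ X]addr0; apply: is_deriveD_fun.
by rewrite -[X in is_derive _ _ _ X]mulr1; apply: is_deriveMl_fun.
Qed.

Lemma is_derive_linear k x : is_derive x 1 (fun y => k * y) k.
Proof. by have := is_derive_affine k 0 x; under eq_fun do rewrite addr0. Qed.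

Lemma is_derive_square k x : is_derive x 1 (fun y => k * y ^+ 2) (2 * k * x).
Proof.
have -> : 2 * k * x = k * (1 * x + x * 1) by ring.
apply: is_deriveMl_fun.
have -> : (fun y : R => y ^+ 2) = (fun y => y * y) by apply/funext => y; rewrite expr2.
exact: is_deriveM_fun.
Qed.

Lemma is_derive1_unique f x d e : is_derive x 1 f d -> is_derive x 1 f e -> d = e.
Proof. by move=> [_ <-] [_ <-]. Qed.

Lemma is_derive1_near f g x d e : 0 < e -> (forall s, `|s - x| < e -> f s = g s) ->
  is_derive x 1 f d -> is_derive x 1 g d.
Proof.
move=> e0 fg /is_derive1P fx; apply/is_derive1P => k k0.
have [del del0 H] := fx k k0; exists (Num.min del e); first by rewrite lt_min del0.
move=> h; rewrite lt_min => /andP[hd he]; rewrite -!fg; first exact: H.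
  by rewrite subrr normr0.
by rewrite [x + h]addrC addrK.
Qed.

(** The singular term [k y / y] tends to the derivative of [k] at 0, because [k 0 = 0]. Serves both
    the evolution equation and its time derivative. *)
Lemma axis_limit (f A k : R -> R) (m k1 f0 A0 e : R) : 0 < e ->
  (forall y, 0 < y < e -> f y = A y + m * (k y / y)) ->
  f y @[y --> 0^'+] --> f0 -> A y @[y --> 0^'+] --> A0 ->
  k 0 = 0 -> is_derive (0 : R) 1 k k1 -> f0 = A0 + m * k1.
Proof.
move=> e0 fE ff0 AA0 k0 /is_derive1P kd.
have kc : k y / y @[y --> 0^'+] --> k1.
  apply/cvgrPdist_le => eps eps0; have [del del0 H] := kd eps eps0.
  near=> h; have h0 : 0 < h by [].
  have := H h; rewrite gtr0_norm// add0r k0 subr0.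
  have -> : h < del by near: h; exact: nbhs_right_lt.
  move=> /(_ isT); rewrite -ler_pdivrMr//; apply: le_trans.
  have -> : k1 - k h / h = - ((k h - k1 * h) / h) by field; exact: lt0r_neq0.
  by rewrite normrN normf_div [`|h|]gtr0_norm.
apply: (cvg_unique _ ff0) => //.
have : A y + m * (k y / y) @[y --> 0^'+] --> A0 + m * k1.
  by apply: cvgD => //; apply: cvgMr.
apply: cvg_trans; apply: near_eq_cvg; near=> y; rewrite fE//.
by apply/andP; split; near: y; [exact: nbhs_right_gt|exact: nbhs_right_lt].
Unshelve. all: by end_near. Qed.

(** The barrier of the maximum principles. Its derivatives are multiples of itself, so at a touching
    point every term carries the same factor; [lam] governs the slope at the free boundary and [K]
    the growth or decay in time. *)
Definition gauss (K lam y t : R) : R := expR (K * t + lam * y ^+ 2).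

Section Gauss.
Variables K lam : R.
Local Notation Phi := (gauss K lam).

Lemma gauss_gt0 (y t : R) : 0 < Phi y t. Proof. exact: expR_gt0. Qed.

Lemma gauss_continuous : continuous (jointly Phi).
Proof.
move=> -[y t]; apply: continuous_comp; last exact: continuous_expR.
apply: cvgD; first by apply: cvgMr; exact: cvg_snd.
apply: cvgMr; apply: (@continuous_comp _ _ _ fst (fun x : R => x ^+ 2)).
  exact: cvg_fst.
exact: exprn_continuous.
Qed.

Lemma is_derive_gauss_y (y t : R) : is_derive y 1 (Phi^~ t) (2 * lam * y * Phi y t).
Proof.
rewrite mulrC; apply: is_derive_expR_fun; rewrite -[X in is_derive _ _ _ X]add0r.
by apply: is_deriveD_fun; exact: is_derive_square.
Qed.

Lemma is_derive_gauss_yy (y t : R) : is_derive y 1 (fun y => 2 * lam * y * Phi y t)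
  ((2 * lam + 4 * lam ^+ 2 * y ^+ 2) * Phi y t).
Proof.
apply: (is_derive_eq (is_deriveM_fun (is_derive_linear (2 * lam) y) (is_derive_gauss_y y t))).
ring.
Qed.

Lemma is_derive_gauss_t (y t : R) : is_derive t 1 (Phi y) (K * Phi y t).
Proof. by rewrite mulrC; apply: is_derive_expR_fun; exact: is_derive_affine. Qed.

End Gauss.

End DerivativeRules.

(** * Positivity of the velocity *)

(* A solution of (P) together with the partial derivatives
   p = w_y, q = w_yy, v = w_t, vy = v_y = p_t, vyy = v_yy = q_t, vt = v_tt,
   and m = n - 1.  Unlike [global_solution], this package is visibly invariant
   under the reflection z |-> - z. *)
Record profile_flow (R : realType) (m : R) (wS wS1 wS2 r r1 : R -> R)
    (w p q v vy vyy vt : R -> R -> R) : Prop := ProfileFlow {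
  pf_wS : forall z : R, is_derive z 1 wS (wS1 z);
  pf_wS1 : forall z : R, is_derive z 1 wS1 (wS2 z);
  pf_wS2 : continuous wS2;
  pf_r_gt0 : forall t : R, 0 <= t -> 0 < r t;
  pf_r_cont : {within [set t | 0 <= t], continuous r};
  pf_r1 : forall t : R, 0 < t -> is_derive t 1 r (r1 t);
  pf_w_cont : {within space_time r, continuous (jointly w)};
  pf_p_cont : {within space_time r, continuous (jointly p)};
  pf_q_cont : {within space_time r, continuous (jointly q)};
  pf_v_cont : {within space_time r, continuous (jointly v)};
  pf_wy : forall y t : R, 0 <= t -> 0 <= y <= r t -> is_derive y 1 (w^~ t) (p y t);
  pf_py : forall y t : R, 0 <= t -> 0 <= y <= r t -> is_derive y 1 (p^~ t) (q y t);
  pf_wt : forall y t : R, 0 <= t -> 0 <= y <= r t -> is_derive t 1 (w y) (v y t);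
  pf_pt : forall y t : R, 0 < t -> 0 <= y <= r t -> is_derive t 1 (p y) (vy y t);
  pf_qt : forall y t : R, 0 < t -> 0 <= y <= r t -> is_derive t 1 (q y) (vyy y t);
  pf_vy : forall y t : R, 0 < t -> 0 <= y <= r t -> is_derive y 1 (v^~ t) (vy y t);
  pf_vyy : forall y t : R, 0 < t -> 0 <= y <= r t -> is_derive y 1 (vy^~ t) (vyy y t);
  pf_vt : forall y t : R, 0 < t -> 0 <= y <= r t -> is_derive t 1 (v y) (vt y t);
  pf_vyy_axis : forall t : R, 0 < t -> {for (0 : R), continuous (vyy^~ t)};
  pf_vt_axis : forall t : R, 0 < t -> {for (0 : R), continuous (vt^~ t)};
  pf_w_boundary_t : forall t : R, 0 < t ->
    is_derive t 1 (fun s => w (r s) s) (p (r t) t * r1 t + v (r t) t);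
  pf_p_boundary_t : forall t : R, 0 < t ->
    is_derive t 1 (fun s => p (r s) s) (q (r t) t * r1 t + vy (r t) t);
  pf_pde : forall y t : R, 0 <= t -> 0 < y < r t ->
    v y t = q y t / (1 + p y t ^+ 2) + m * (p y t / y);
  pf_boundary : forall t : R, 0 <= t -> r t = wS (w (r t) t);
  pf_neumann : forall t : R, 0 <= t -> p (r t) t = - wS1 (w (r t) t);
  pf_axis : forall t : R, 0 <= t -> p 0 t = 0 }.

Section ProfileFlow.
Variable R : realType.
Variables (m : R) (wS wS1 wS2 r r1 : R -> R).
Variables (w p q v vy vyy vt : R -> R -> R).
Hypothesis m_gt0 : 0 < m.
Hypothesis F : profile_flow m wS wS1 wS2 r r1 w p q v vy vyy vt.
Implicit Types (y t T K e lam : R).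

Local Notation b := (fun t => w (r t) t).

Let W2_gt0 y t : 0 < 1 + p y t ^+ 2.
Proof. by rewrite ltr_pwDl// sqr_ge0. Qed.

Let W2_neq0 y t : 1 + p y t ^+ 2 != 0.
Proof. exact: lt0r_neq0. Qed.

Lemma within_times (f : R -> R) t0 t1 : 0 <= t0 ->
  {within [set t | 0 <= t], continuous f} ->
  {within [set t | t0 <= t <= t1], continuous f}.
Proof.
by move=> t00; apply: continuous_subspaceW => t /= /andP[tt _]; exact: le_trans tt.
Qed.

Lemma within_domain (f : R -> R -> R) t0 t1 : 0 <= t0 ->
  {within space_time r, continuous (jointly f)} ->
  {within moving_domain r t0 t1, continuous (jointly f)}.
Proof.
move=> t00; apply: continuous_subspaceW => -[y t] [/= /andP[tt _] yr].
by split => //=; exact: le_trans tt.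
Qed.

Lemma within_slice (f : R -> R -> R) t : 0 <= t ->
  {within space_time r, continuous (jointly f)} ->
  {within `[0, r t], continuous (f^~ t)}.
Proof.
move=> t0 /within2P fc; rewrite (_ : [set` _] = [set y | 0 <= y <= r t]); last first.
  by apply/seteqP; split => y /=; rewrite in_itv.
apply/within1P => a ar e e0.
have [|d d0 H] := fc a t _ e e0; first by split.
by exists d => // y yr ya; apply: H => //; rewrite ?subrr ?normr0.
Qed.

Lemma right_limit (f : R -> R -> R) t : 0 <= t ->
  {within space_time r, continuous (jointly f)} ->
  f y t @[y --> 0^'+] --> f 0 t.
Proof.
move=> t0 /(within_slice t0) fc.
by have [_ + _] := (continuous_within_itvP _ (pf_r_gt0 F t0)).1 fc.
Qed.

Lemma boundary_continuous (f : R -> R -> R) :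
  {within space_time r, continuous (jointly f)} ->
  {within [set t | 0 <= t], continuous (fun t => f (r t) t)}.
Proof.
move=> /within2P fc; apply/within1P => a a0 e e0.
have inD t : 0 <= t -> space_time r (r t, t).
  by move=> t0; split => //=; rewrite lexx (ltW (pf_r_gt0 F t0)).
have [d d0 H] := fc _ _ (inD a a0) e e0.
have [d' d'0 H'] := (within1P _ _).1 (pf_r_cont F) a a0 d d0.
exists (Num.min d' d); first by rewrite lt_min d'0.
move=> t t0; rewrite lt_min => /andP[td' td]; apply: H => //; first exact: inD.
exact: H'.
Qed.

Lemma pde_axis t : 0 <= t -> v 0 t = (1 + m) * q 0 t.
Proof.
move=> t0; have rt := pf_r_gt0 F t0; rewrite mulrDl mul1r.
apply: (axis_limit rt (fun y => pf_pde F t0)).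
- exact: right_limit (pf_v_cont F).
- rewrite -[q 0 t]divr1 -[X in _ / X](_ : 1 + p 0 t ^+ 2 = 1); last first.
    by rewrite (pf_axis F t0) expr0n addr0.
  apply: cvgM; first exact: right_limit (pf_q_cont F).
  apply: cvgV; first exact: W2_neq0.
  apply: cvgD; first exact: cvg_cst.
  by rewrite expr2; under eq_fun do rewrite expr2; apply: cvgM; exact: right_limit (pf_p_cont F).
- exact: (pf_axis F).
- by apply: (pf_py F) => //; rewrite lexx ltW.
Qed.

(** An interior radius stays interior for nearby times; this permits differentiating the equation in
    time at fixed [y]. *)
Lemma time_nbhs y t : 0 < t -> 0 <= y < r t ->
  exists2 e, 0 < e & forall s, `|s - t| < e -> 0 < s /\ y < r s.
Proof.
move=> t0 /andP[y0 yr].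
have [||d d0 H] := (within1P _ _).1 (pf_r_cont F) t _ (r t - y); rewrite ?subr_gt0//=.
  exact: ltW.
exists (Num.min t d); first by rewrite lt_min t0.
move=> s; rewrite lt_min => /andP[st sd].
have s0 : 0 < s by move: st; rewrite ltr_norml; lra.
by split=> //; have := H s (ltW s0) sd; rewrite ltr_norml; lra.
Qed.

Lemma vy_axis t : 0 < t -> vy 0 t = 0.
Proof.
move=> t0; have rt := pf_r_gt0 F (ltW t0).
have Dp : is_derive t 1 (p 0) (vy 0 t) by apply: (pf_pt F); rewrite ?lexx ?ltW.
apply: (is_derive1_unique Dp); apply: (@is_derive1_near _ (cst 0) _ _ _ t t0).
  by move=> s; rewrite ltr_norml => st; rewrite (pf_axis F)//; lra.
Qed.

(** The linearised equation for the velocity: [pf_pde] differentiated in time, with [p_t = vy] and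
    [q_t = vyy]. *)
Lemma pde_time y t : 0 < t -> 0 < y < r t ->
  vt y t = vyy y t / (1 + p y t ^+ 2)
    - 2 * q y t * p y t * vy y t / (1 + p y t ^+ 2) ^+ 2 + m * (vy y t / y).
Proof.
move=> t0 /andP[y0 yr]; have yy : 0 <= y < r t by rewrite ltW.
have yy' : 0 <= y <= r t by rewrite !ltW.
have [e e0 H] := time_nbhs t0 yy.
apply: (is_derive1_unique (pf_vt F t0 yy')).
apply: (@is_derive1_near _
  (fun t => q y t * (1 + p y t * p y t)^-1 + m * (y^-1 * p y t)) _ _ _ e e0).
  move=> s /H[s0 ys]; rewrite (pf_pde F (ltW s0)) ?y0//.
  by rewrite expr2 [y^-1 * _]mulrC.
have Dp := pf_pt F t0 yy'; have Dq := pf_qt F t0 yy'.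
have DW : is_derive t 1 (fun s => 1 + p y s * p y s)
    (0 + (vy y t * p y t + p y t * vy y t)).
  by apply: is_deriveD_fun; exact: is_deriveM_fun.
have W0 : 1 + p y t * p y t != 0 by rewrite -expr2; exact: W2_neq0.
have DV := is_deriveV_fun (f := fun s => 1 + p y s * p y s) W0 DW.
have D := is_deriveD_fun (is_deriveM_fun Dq DV)
  (is_deriveMl_fun m (is_deriveMl_fun y^-1 Dp)).
apply: (is_derive_eq D).
by field; rewrite W2_neq0 gt_eqF.
Qed.

Lemma pde_time_axis t : 0 < t -> vt 0 t = (1 + m) * vyy 0 t.
Proof.
move=> t0; have rt := pf_r_gt0 F (ltW t0); rewrite mulrDl mul1r.
have tt := ltW t0.
apply: (axis_limit rt (fun y => pde_time t0)).
- by apply: cvg_at_right_filter; exact: (pf_vt_axis F).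
- have -> : vyy 0 t = vyy 0 t / (1 + p 0 t ^+ 2)
      - 2 * q 0 t * p 0 t * vy 0 t / (1 + p 0 t ^+ 2) ^+ 2.
    by rewrite vy_axis// mulr0 mul0r subr0 (pf_axis F tt) expr0n addr0 divr1.
  have cp : p y t @[y --> 0^'+] --> p 0 t by exact: right_limit (pf_p_cont F).
  have cV : (1 + p y t ^+ 2)^-1 @[y --> 0^'+] --> (1 + p 0 t ^+ 2)^-1.
    apply: cvgV; first exact: W2_neq0.
    apply: cvgD; first exact: cvg_cst.
    by rewrite expr2; under eq_fun do rewrite expr2; exact: cvgM.
  apply: cvgB.
    by apply: cvgM => //; apply: cvg_at_right_filter; exact: (pf_vyy_axis F).
  under eq_fun do rewrite -exprVn expr2.
  rewrite -exprVn expr2; apply: cvgM; last exact: cvgM.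
  apply: cvgM.
    apply: cvgM => //; apply: cvgM; first exact: cvg_cst.
    exact: right_limit (pf_q_cont F).
  apply: cvg_at_right_filter.
  have D : is_derive (0 : R) 1 (vy^~ t) (vyy 0 t) by apply: (pf_vyy F); rewrite ?lexx ?ltW.
  exact: is_derive1_continuous D.
- exact: vy_axis.
- by apply: (pf_vyy F); rewrite ?lexx ?ltW.
Qed.

(* Differentiating r = wS(b) and p(r, t) = - wS'(b) in time. *)
Lemma radius_velocity t : 0 < t ->
  r1 t = - p (r t) t * v (r t) t / (1 + p (r t) t ^+ 2).
Proof.
move=> t0; have tt := ltW t0.
have E : r1 t = wS1 (w (r t) t) * (p (r t) t * r1 t + v (r t) t).
  apply: (is_derive1_unique (pf_r1 F t0)).
  apply: (@is_derive1_near _ (wS \o b) _ _ _ t t0).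
    by move=> s; rewrite ltr_norml => st; rewrite /= -(pf_boundary F)//; lra.
  by apply: is_derive1_comp; [exact: (pf_wS F)|exact: (pf_w_boundary_t F)].
(* By the Neumann condition [E] reads [r1 = - p * (p * r1 + v)], which is linear in [r1] with
   coefficient [1 + p ^+ 2]. *)
apply: (mulIf (W2_neq0 (r t) t)); rewrite divfK//.
by move: E; rewrite -[wS1 _]opprK -(pf_neumann F tt) => E; rewrite mulrDr mulr1 {1}E; ring.
Qed.

Lemma boundary_velocity t : 0 < t ->
  is_derive t 1 b (v (r t) t / (1 + p (r t) t ^+ 2)).
Proof.
move=> t0; apply: (is_derive_eq (pf_w_boundary_t F t0)).
by rewrite radius_velocity//; field; exact: W2_neq0.
Qed.

(** The time derivative of the Neumann condition along the boundary, solved for [vy] after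
    eliminating [r1]. The factor in front of [v] is bounded on bounded time intervals. *)
Lemma velocity_robin t : 0 < t ->
  vy (r t) t = (q (r t) t * p (r t) t - wS2 (w (r t) t)) / (1 + p (r t) t ^+ 2)
               * v (r t) t.
Proof.
move=> t0; have tt := ltW t0.
have E : q (r t) t * r1 t + vy (r t) t =
    - (wS2 (w (r t) t) * (v (r t) t / (1 + p (r t) t ^+ 2))).
  apply: (is_derive1_unique (pf_p_boundary_t F t0)).
  apply: (@is_derive1_near _ (fun s => - wS1 (b s)) _ _ _ t t0).
    by move=> s; rewrite ltr_norml => st; rewrite (pf_neumann F)//; lra.
  apply: is_deriveN_fun; apply: (is_derive1_comp (pf_wS1 F _)).
  exact: boundary_velocity.
rewrite -[vy (r t) t](addKr (q (r t) t * r1 t)) E radius_velocity//.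
by field; exact: W2_neq0.
Qed.

Lemma velocity_ge0 : (forall y, 0 <= y <= r 0 -> 0 <= v y 0) ->
  forall y t, 0 <= t -> 0 <= y <= r t -> 0 <= v y t.
Proof.
move=> v_init y0 T T0 y0r.
have rpos t : 0 <= t <= T -> 0 < r t by move=> /andP[t0 _]; exact: (pf_r_gt0 F).
have rc := @within_times r 0 T (lexx 0) (pf_r_cont F).
have dom f : _ -> _ := @within_domain f 0 T (lexx 0).
have [M M0 HM] := bounded_on_domain T0 rpos rc (dom _ (pf_p_cont F)).
have [N N0 HN] := bounded_on_domain T0 rpos rc (dom _ (pf_q_cont F)).
have [Y Y0 HY] : exists2 Y, 0 < Y & forall t, 0 <= t <= T -> r t <= Y.
  have [|Y Y0 HY] := bounded_on_domain T0 rpos rc (F := fun y _ => y).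
    by apply: continuous_subspaceT => x; exact: cvg_fst.
  exists Y => // t tt; have := HY (r t) t tt.
  by rewrite lexx (ltW (rpos t tt)) => /(_ isT); rewrite gtr0_norm// rpos.
have [S S0 HS] : exists2 S, 0 < S & forall t, 0 <= t <= T -> `|wS2 (b t)| <= S.
  have bc : {within `[0, T], continuous (fun t => `|wS2 (b t)|)}.
    apply: (@within_continuous_comp R _ _ _ b (fun x => `|wS2 x|)).
      by move=> x _; apply: continuous_comp; [exact: (pf_wS2 F)|exact: (@norm_continuous _ R)].
    apply: continuous_subspaceW (boundary_continuous (pf_w_cont F)) => t /=.
    by rewrite in_itv/= => /andP[].
  have [c _ H] := EVT_max T0 bc.
  exists (`|wS2 (b c)| + 1); first by rewrite ltr_wpDl.
  by move=> t tt; rewrite ler_wpDr// H// in_itv.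
have [rho rho0 Hrho] := radius_lower_bound T0 rpos rc.
(* The Robin coefficient is at most [N * M + S], hence at most [lam * r t]; the boundary slope
   [2 * lam * r t] of the barrier exceeds it, relative to the height of the barrier. *)
pose lam := (N * M + S) / rho.
have lam0 : 0 < lam by rewrite divr_gt0// addr_gt0// mulr_gt0.
have lam_rho : N * M + S = lam * rho by rewrite /lam divfK// gt_eqF.
clearbody lam.
(* In order: the second derivative of the barrier (two terms), the first-order term of the
   linearised equation, the radial term, and 1 for strictness. *)
pose K := 2 * lam + 4 * lam ^+ 2 * Y ^+ 2 + 4 * lam * N * M * Y + 2 * m * lam + 1.
pose Phi := gauss K lam; have Phi0 y t : 0 < Phi y t := gauss_gt0 K lam y t.
rewrite leNgt; apply/negP => vneg.
(* With this factor the barrier exactly cancels the supposed negative velocity at [(y0, T)], whereas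
   the minimum principle makes the sum positive. *)
pose e := - v y0 T / Phi y0 T.
have e0 : 0 < e by rewrite divr_gt0// oppr_gt0.
suff : 0 < v y0 T + e * Phi y0 T by rewrite /e divfK ?gt_eqF// subrr ltxx.
have Tin : 0 <= T <= T by rewrite T0 lexx.
apply: (min_principle T0 rpos rc (z := fun y t => v y t + e * Phi y t)
  (zy := fun y t => vy y t + e * (2 * lam * y * Phi y t))
  (zyy := fun y t => vyy y t + e * ((2 * lam + 4 * lam ^+ 2 * y ^+ 2) * Phi y t))
  (zt := fun y t => vt y t + e * (K * Phi y t))) => //.
- apply: (@within_continuousD _ _ R _ (jointly v) (fun x => e * jointly Phi x)).
    exact: dom (pf_v_cont F).
  have ePhiC : continuous (fun x : R * R => e * jointly Phi x).
    by move=> x; have := @gauss_continuous R K lam x; exact: cvgMr.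
  exact: (continuous_subspaceT ePhiC).
- by move=> y /v_init vy0; rewrite ltr_wpDl// mulr_gt0.
- move=> y t /andP[t0 _] yr; split.
  + exact: (is_deriveD_fun (pf_vy F t0 yr) (is_deriveMl_fun e (is_derive_gauss_y K lam y t))).
  + exact: (is_deriveD_fun (pf_vyy F t0 yr) (is_deriveMl_fun e (is_derive_gauss_yy K lam y t))).
  + exact: (is_deriveD_fun (pf_vt F t0 yr) (is_deriveMl_fun e (is_derive_gauss_t K lam y t))).
- by move=> t /andP[t0 _]; rewrite vy_axis// mulr0 mul0r mulr0 addr0.
- move=> t /andP[t0 tT]; have tt : 0 <= t <= T by rewrite ltW.
  have rr : 0 <= r t <= r t by rewrite lexx (ltW (rpos t tt)).
  have P0 := Phi0 (r t) t; rewrite velocity_robin//.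
  (* At a touching point [v] equals minus the barrier, so the Robin term becomes [- c] times the
     barrier. *)
  set c := _ / (1 + p (r t) t ^+ 2); move=> /eqP; rewrite addr_eq0 => /eqP ->.
  have cle : `|c| <= N * M + S.
    rewrite /c normrM [X in _ * X]ger0_norm ?invr_ge0 ?(ltW (W2_gt0 _ _))//.
    rewrite ler_pdivrMr// (le_trans (ler_normB _ _))// normrM.
    have := ler_pM (normr_ge0 _) (normr_ge0 _) (HN _ _ tt rr) (HM _ _ tt rr).
    move=> /lerD /(_ (HS t tt)) /le_trans; apply.
    by rewrite ler_peMr ?lerDl ?sqr_ge0// addr_ge0 ?mulr_ge0// ltW.
  have lamr : N * M + S <= lam * r t.
    by rewrite lam_rho ler_pM2l// Hrho.
  have E0 : 0 < e * Phi (r t) t by rewrite mulr_gt0.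
  have -> : c * - (e * Phi (r t) t) + e * (2 * lam * r t * Phi (r t) t) =
      (2 * (lam * r t) - c) * (e * Phi (r t) t) by ring.
  rewrite mulr_gt0//; move: cle; rewrite ler_norml => /andP[_].
  have : 0 < lam * r t by rewrite mulr_gt0// rpos.
  lra.
- move=> y t /andP[t0 tT] /andP[yge0 yr] _.
  have tt : 0 <= t <= T by rewrite ltW.
  have yy : 0 <= y <= r t by rewrite yge0 ltW.
  have yY : y <= Y by apply: le_trans (ltW yr) _; exact: HY.
  set E := e * Phi y t; have E0 : 0 < E by rewrite mulr_gt0.
  have -> : e * (2 * lam * y * Phi y t) = 2 * lam * y * E by rewrite /E; ring.
  have -> : e * ((2 * lam + 4 * lam ^+ 2 * y ^+ 2) * Phi y t) =
    (2 * lam + 4 * lam ^+ 2 * y ^+ 2) * E by rewrite /E; ring.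
  have -> : e * (K * Phi y t) = K * E by rewrite /E; ring.
  move=> /eqP; rewrite addr_eq0 => /eqP vyE; rewrite -lerBlDr sub0r => vyyE.
  clearbody E; have y2 : y ^+ 2 <= Y ^+ 2 by rewrite ler_pXn2r// nnegrE ltW.
  have l2 : lam ^+ 2 * y ^+ 2 * E <= lam ^+ 2 * Y ^+ 2 * E.
    by rewrite ler_pM2r// ler_wpM2l// sqr_ge0.
  have A0 : 0 <= lam ^+ 2 * Y ^+ 2 * E.
    by rewrite mulr_ge0 ?(ltW E0)// mulr_ge0// sqr_ge0.
  have B0 : 0 < lam * N * M * Y * E by rewrite !mulr_gt0.
  have C0 : 0 < lam * E by rewrite mulr_gt0.
  have D0 : 0 < m * lam * E by rewrite !mulr_gt0.
  move: yge0; rewrite le_eqVlt => /orP[/eqP y00|ygt0].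
    move: vyyE; rewrite -y00 pde_time_axis// expr0n mulr0 addr0 => vyyE.
    have := ler_wpM2l (ltW m_gt0) vyyE; rewrite /K; lra.
  rewrite pde_time ?ygt0// vyE.
  set a := (1 + p y t ^+ 2)^-1.
  have a0 : 0 < a by rewrite invr_gt0.
  have a1 : a <= 1 by rewrite invf_le1// lerDl sqr_ge0.
  (* The lower bound for [vyy] is nonpositive, so the factor [a], which lies in (0, 1], preserves
     it. *)
  have Avyy : - ((2 * lam + 4 * lam ^+ 2 * y ^+ 2) * E) <= vyy y t * a.
    set G := (X in - X) in vyyE *.
    have G0 : 0 <= G.
      have := sqr_ge0 (lam * y); rewrite exprMn => ly.
      by apply: mulr_ge0; [lra|exact: ltW].
    apply: (@le_trans _ _ (- G * a)); last by rewrite ler_pM2r.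
    by rewrite mulNr lerN2 ler_piMr.
  have Bq : `|4 * lam * E * (q y t * p y t) * (y * a ^+ 2)| <= 4 * lam * E * (N * M) * Y.
    have ya0 : 0 <= y * a ^+ 2 by rewrite mulr_ge0 ?sqr_ge0 ?(ltW ygt0).
    have yaY : y * a ^+ 2 <= Y.
      apply: le_trans yY; rewrite ler_piMr ?(ltW ygt0)//.
      by rewrite exprn_ile1// ltW.
    rewrite normrM (ger0_norm ya0) ler_pM// normrM.
    have l4 : 0 < 4 * lam * E by rewrite mulr_gt0// mulr_gt0.
    by rewrite (gtr0_norm l4) ler_pM2l// normrM ler_pM ?HN ?HM.
  have -> : 2 * q y t * p y t * - (2 * lam * y * E) / (1 + p y t ^+ 2) ^+ 2 =
      - (4 * lam * E * (q y t * p y t) * (y * a ^+ 2)).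
    by rewrite -exprVn -/a; ring.
  have -> : m * (- (2 * lam * y * E) / y) = - (2 * m * lam * E).
    by field; exact: lt0r_neq0.
  move: Bq; rewrite ler_norml => /andP[Bq _].
  by rewrite /K; lra.
Qed.

End ProfileFlow.

(** * Convergence of upward flows *)

Section UpwardFlow.
Variable R : realType.
Variables (m : R) (wS wS1 wS2 r r1 : R -> R).
Variables (w p q v vy vyy vt : R -> R -> R).
Hypothesis m_gt0 : 0 < m.
Hypothesis F : profile_flow m wS wS1 wS2 r r1 w p q v vy vyy vt.
Hypothesis v_ge0 : forall y t, 0 <= t -> 0 <= y <= r t -> 0 <= v y t.
Implicit Types (y t T s e : R).

Local Notation b := (fun t => w (r t) t).

(** At a negative minimum [c] of the slope over [[0, x]] one has [q <= 0] and [p / c < 0], so the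
    equation would make [v] negative. As [c] may equal [x], only values to its left are compared;
    the endpoint [r t] follows by continuity. *)
Lemma slope_ge0 y t : 0 <= t -> 0 <= y <= r t -> 0 <= p y t.
Proof.
move=> t0.
have interior x : 0 <= x < r t -> 0 <= p x t.
  move=> /andP[x0 xr]; rewrite leNgt; apply/negP => px.
  have pc : {within `[0, x], continuous (p^~ t)}.
    apply: continuous_subspaceW (within_slice t0 (pf_p_cont F)) => s /=.
    by rewrite !in_itv/= => /andP[-> sx]/=; rewrite (le_trans sx) ?ltW.
  have [c] := EVT_min x0 pc; rewrite in_itv/= => /andP[c0 cx] cmin.
  have pcneg : p c t < 0.
    by apply: le_lt_trans px; apply: cmin; rewrite in_itv/= x0 lexx.
  have c_gt0 : 0 < c.
    rewrite lt_neqAle c0 andbT; apply/eqP => c00.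
    by move: pcneg; rewrite -c00 (pf_axis F t0) ltxx.
  have cr : c < r t := le_lt_trans cx xr.
  have cr' : 0 <= c <= r t by rewrite !ltW.
  have qle : q c t <= 0.
    apply: (derive_le0_left (pf_py F t0 cr') c_gt0) => s /andP[s0 sc].
    by apply: cmin; rewrite in_itv/= (le_trans (ltW sc))// andbT; lra.
  have := v_ge0 t0 cr'; rewrite (pf_pde F t0) ?c_gt0// leNgt => /negP; apply.
  rewrite addrC ltr_nwDl//.
    by rewrite pmulr_rlt0// pmulr_llt0// invr_gt0.
  by rewrite pmulr_lle0// invr_gt0 ltr_pwDl// sqr_ge0.
move=> /andP[y0]; rewrite le_eqVlt => /orP[/eqP yr|yr]; last by apply: interior; rewrite y0.
rewrite yr leNgt; apply/negP => pneg; have rt := pf_r_gt0 F t0.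
have /continuous_within_itvP-/(_ rt)[_ _] := within_slice t0 (pf_p_cont F).
move=> /cvgrPdist_lt/(_ (- p (r t) t)); rewrite oppr_gt0 => /(_ pneg) H.
suff : \forall x \near (r t)^'-, False by move=> /filter_ex[].
near=> x; have x0 : 0 < x by [].
have xr : x < r t by near: x; exact: nbhs_left_lt.
have : `|p (r t) t - p x t| < - p (r t) t by near: x.
have := interior x; rewrite (ltW x0) xr => /(_ isT).
by rewrite ltr_norml; lra.
Unshelve. all: by end_near. Qed.

Lemma boundary_slope_le0 t : 0 <= t -> wS1 (b t) <= 0.
Proof.
move=> t0; rewrite -oppr_ge0 -(pf_neumann F t0); apply: slope_ge0 => //.
by rewrite lexx ltW// (pf_r_gt0 F t0).
Qed.

Lemma ndecr_in_time (f df : R -> R) :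
  {within [set t | 0 <= t], continuous f} ->
  (forall t, 0 < t -> is_derive t 1 f (df t)) ->
  (forall t, 0 < t -> 0 <= df t) ->
  forall s t, 0 <= s -> s <= t -> f s <= f t.
Proof.
move=> fc fD df0; apply: ger0_derive1_ndecry.
- by move=> x; rewrite in_itv/= andbT => /fD[].
- by move=> x; rewrite in_itv/= andbT => x0; rewrite (is_derive1_derive1 (fD x x0)) df0.
- by apply: continuous_subspaceW fc => x /=; rewrite in_itv/= andbT.
Qed.

Lemma boundary_height_ndecr s t : 0 <= s -> s <= t -> b s <= b t.
Proof.
apply: (@ndecr_in_time b _ (boundary_continuous F (pf_w_cont F))
  (fun t => @boundary_velocity _ _ _ _ _ _ _ _ _ _ _ _ _ _ F t)).
move=> x x0; rewrite divr_ge0//; last by rewrite addr_ge0// sqr_ge0.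
by apply: v_ge0; rewrite ?lexx ltW// (pf_r_gt0 F (ltW x0)).
Qed.

(** The boundary speed [- p * v / (1 + p ^+ 2)] is nonpositive. Consequently a radius in the domain
    at time [t] was in it at all earlier times, and [r 0] bounds every radius. *)
Lemma radius_nincr s t : 0 <= s -> s <= t -> r t <= r s.
Proof.
move=> s0 st; rewrite -lerN2; move: s t s0 st.
apply: (@ndecr_in_time (fun t => - r t) (fun t => - r1 t)).
- by have := pf_r_cont F => rc x; apply: cvgN; exact: rc.
- by move=> t t0; apply: is_deriveN_fun; exact: (pf_r1 F).
- move=> t t0; have tt := ltW t0.
  have rr : 0 <= r t <= r t by rewrite lexx ltW// (pf_r_gt0 F tt).
  rewrite (radius_velocity F t0) !mulNr opprK divr_ge0//.
    by rewrite mulr_ge0// ?slope_ge0// v_ge0.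
  by rewrite addr_ge0// sqr_ge0.
Qed.

Lemma height_ndecr_y y1 y2 t : 0 <= t -> 0 <= y1 -> y1 <= y2 -> y2 <= r t ->
  w y1 t <= w y2 t.
Proof.
move=> t0 y10; rewrite le_eqVlt => /orP[/eqP->//|y12] y2r.
have inD x : y1 <= x <= y2 -> 0 <= x <= r t.
  by move=> /andP[yx xy]; rewrite (le_trans y10 yx) (le_trans xy y2r).
have [|c /andP[yc cy] E] := @mvt _ (w^~ t) (p^~ t) _ _ y12.
  by move=> x /inD; exact: (pf_wy F t0).
rewrite -subr_ge0 E mulr_ge0 ?subr_ge0 ?(ltW y12)//.
by apply: slope_ge0 => //; apply: inD; rewrite !ltW.
Qed.

Lemma height_ndecr_t y s t : 0 <= s -> s <= t -> 0 <= y <= r t -> w y s <= w y t.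
Proof.
move=> s0; rewrite le_eqVlt => /orP[/eqP->//|st] /andP[y0 yr].
have inD x : s <= x <= t -> 0 <= x /\ 0 <= y <= r x.
  move=> /andP[sx xt]; have x0 := le_trans s0 sx; split => //.
  by rewrite y0 (le_trans yr)// radius_nincr.
have [|c /andP[sc ct] E] := @mvt _ (w y) (v y) _ _ st.
  by move=> x /inD[x0 yx]; exact: (pf_wt F x0 yx).
rewrite -subr_ge0 E mulr_ge0 ?subr_ge0 ?(ltW st)//.
have [|c0 yc] := inD c; first by rewrite !ltW.
exact: v_ge0.
Qed.

Lemma height_le_boundary y t : 0 <= t -> 0 <= y <= r t -> w y t <= b t.
Proof. by move=> t0 /andP[y0 yr]; exact: height_ndecr_y. Qed.

Let r_pos t0 t1 t : 0 <= t0 -> t0 <= t <= t1 -> 0 < r t.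
Proof. by move=> t00 /andP[tt _]; apply: (pf_r_gt0 F); exact: le_trans tt. Qed.

(* The slope of w at a touching point with k y^2 is 2 k y, and w_yy >= 2 k
   there, so that w_t >= 2 m k: the paraboloid may rise with speed m k. *)
Lemma paraboloid_below (k C t0 t1 : R) : 0 < k -> 0 <= t0 -> t0 <= t1 ->
  (forall y, 0 <= y <= r t0 -> k * y ^+ 2 < w y t0 + C) ->
  (forall t, t0 < t <= t1 -> w (r t) t + C = k * r t ^+ 2 + k * m * (t - t0) ->
     2 * k * r t < p (r t) t) ->
  forall y t, t0 <= t <= t1 -> 0 <= y <= r t ->
    k * y ^+ 2 + k * m * (t - t0) < w y t + C.
Proof.
move=> k0 t00 t01 init bdry y1 s ts ys.
pose z y t := w y t + (- (k * m) * t + (C + k * m * t0)) - k * y ^+ 2.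
have zE y t : z y t = w y t + C - (k * y ^+ 2 + k * m * (t - t0)).
  by rewrite /z; ring.
rewrite -subr_gt0 -zE.
have km : 0 < k * m by rewrite mulr_gt0.
apply: (min_principle t01 (fun t => @r_pos t0 t1 t t00) (within_times t00 (pf_r_cont F)) (z := z)
  (zy := fun y t => p y t - 2 * k * y) (zyy := fun y t => q y t - 2 * k)
  (zt := fun y t => v y t - k * m)) => //.
- apply: (@within_continuousB _ _ R _
    (fun x => jointly w x + (- (k * m) * x.2 + (C + k * m * t0)))
    (fun x => k * x.1 ^+ 2)).
    apply: (@within_continuousD _ _ R _ (jointly w)
      (fun x => - (k * m) * x.2 + (C + k * m * t0))).
      exact: (within_domain t00 (pf_w_cont F)).
    apply: continuous_subspaceT => x; apply: cvgD; last exact: cvg_cst.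
    by apply: cvgMr; exact: cvg_snd.
  apply: continuous_subspaceT => x; apply: cvgMr.
  apply: (@continuous_comp _ _ _ fst (fun x : R => x ^+ 2)); first exact: cvg_fst.
  exact: exprn_continuous.
- by move=> y yr; rewrite zE subrr mulr0 addr0 subr_gt0 init.
- move=> y t /andP[tt _] yr; have t_gt0 := le_lt_trans t00 tt; have t_ge0 := ltW t_gt0; split.
  + rewrite -[p y t]addr0.
    exact: (is_deriveB_fun (is_deriveD_fun (pf_wy F t_ge0 yr) (is_derive_cst _ y 1))
      (is_derive_square k y)).
  + exact: (is_deriveB_fun (pf_py F t_ge0 yr) (is_derive_linear (2 * k) y)).
  + rewrite -[_ - _]subr0.
    exact: (is_deriveB_fun (is_deriveD_fun (pf_wt F t_ge0 yr) (is_derive_affine _ _ t))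
      (is_derive_cst _ t 1)).
- by move=> t /andP[tt _]; rewrite mulr0 subr0 (pf_axis F)// (le_trans t00)// ltW.
- move=> t tt; rewrite zE subr_gt0 => /eqP; rewrite subr_eq0 => /eqP.
  exact: bdry.
- move=> y t /andP[tt _] /andP[y0 yr] _ /eqP; rewrite subr_eq0 => /eqP py.
  rewrite subr_ge0 => qy; have t_ge0 := ltW (le_lt_trans t00 tt).
  move: y0; rewrite le_eqVlt => /orP[/eqP y00|y0].
    rewrite -y00 (pde_axis F t_ge0); move: qy; rewrite -y00 => qy.
    have : m * (2 * k) <= m * q 0 t by rewrite ler_pM2l.
    lra.
  rewrite (pf_pde F t_ge0) ?y0// py.
  (* The radial term alone gives twice the speed [k * m] of the paraboloid; the surplus makes the
     inequality strict. *)
  have -> : m * (2 * k * y / y) = 2 * (k * m) by field; exact: lt0r_neq0.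
  have : 0 <= q y t / (1 + (2 * k * y) ^+ 2).
    rewrite divr_ge0//; last by rewrite addr_ge0// sqr_ge0.
    by apply: le_trans qy; rewrite mulr_ge0// ltW.
  lra.
Qed.

(* The flat disk at a critical height c is a stationary solution. *)
Lemma below_critical_height c : wS1 c = 0 -> b 0 < c ->
  forall t, 0 <= t -> b t < c.
Proof.
move=> c_crit bc T T0.
have rc := within_times (t1 := T) (lexx 0) (pf_r_cont F).
have rpos t : 0 <= t <= T -> 0 < r t by exact: r_pos.
have [rho rho0 Hrho] := radius_lower_bound T0 rpos rc.
(* Half of the initial gap: as [Phi <= 1], the barrier starts below [c - w], and at a touching point
   the height is within [e] of [c], where [wS2] is bounded by [L]. *)
pose e := (c - b 0) / 2; have e0 : 0 < e by rewrite divr_gt0// subr_gt0.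
have [L L0 HL] : exists2 L, 0 < L & forall x, c - e <= x <= c -> `|wS2 x| <= L.
  have cc : c - e <= c by lra.
  have W2c : {within `[c - e, c], continuous (fun x => `|wS2 x|)}.
    apply: continuous_subspaceT => x; apply: continuous_comp; first exact: (pf_wS2 F).
    exact: (@norm_continuous _ R).
  have [d _ H] := EVT_max cc W2c.
  exists (`|wS2 d| + 1); first by rewrite ltr_wpDl.
  by move=> x xx; rewrite ler_wpDr// H// in_itv.
pose lam := L / rho.
have lam0 : 0 < lam by rewrite divr_gt0.
have lam_rho : L = lam * rho by rewrite /lam divfK// gt_eqF.
clearbody lam.
(* A bound for the diffusion and the radial term at a touching point, plus 1. The part of the second
   derivative that is quadratic in [y] has a favourable sign, so no upper bound on the radius
   enters. *)
pose K := 2 * lam + 2 * m * lam + 1.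
have K0 : 0 < K.
  have := mulr_gt0 m_gt0 lam0; rewrite /K; lra.
pose Phi := gauss (- K) (- lam).
have Phi0 y t : 0 < Phi y t by exact: gauss_gt0.
have Phi1 y t : 0 <= t -> Phi y t <= 1.
  move=> t0; rewrite -expR0 ler_expR.
  have := mulr_ge0 (ltW K0) t0; have := mulr_ge0 (ltW lam0) (sqr_ge0 y); lra.
suff : 0 < c - w (r T) T - e * Phi (r T) T.
  have := mulr_gt0 e0 (Phi0 (r T) T); lra.
have Tin : 0 <= T <= T by rewrite T0 lexx.
have rT := ltW (rpos T Tin).
apply: (min_principle T0 rpos rc (z := fun y t => c - w y t - e * Phi y t)
  (zy := fun y t => 0 - p y t - e * (2 * - lam * y * Phi y t))
  (zyy := fun y t => 0 - q y t - e * ((2 * - lam + 4 * (- lam) ^+ 2 * y ^+ 2) * Phi y t))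
  (zt := fun y t => 0 - v y t - e * (- K * Phi y t))) => //.
- apply: (@within_continuousB _ _ R _ (fun x => c - jointly w x) (fun x => e * jointly Phi x)).
    apply: (@within_continuousB _ _ R _ (cst c) (jointly w)).
      by apply: continuous_subspaceT => x; exact: cvg_cst.
    exact: (within_domain (lexx 0) (pf_w_cont F)).
  have ePhiC : continuous (fun x : R * R => e * jointly Phi x).
    by move=> x; have := @gauss_continuous R (- K) (- lam) x; exact: cvgMr.
  exact: (continuous_subspaceT ePhiC).
- move=> y yr; have := height_le_boundary (lexx 0) yr.
  have := Phi1 y 0 (lexx 0); rewrite -(ler_pM2l e0) mulr1 /=.
  have : c - w (r 0) 0 = 2 * e by rewrite /e; field.
  lra.
- move=> y t /andP[t0 _] yr; have tt := ltW t0; split.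
  + exact: (is_deriveB_fun (is_deriveB_fun (is_derive_cst c y 1) (pf_wy F tt yr))
      (is_deriveMl_fun e (is_derive_gauss_y _ _ y t))).
  + exact: (is_deriveB_fun (is_deriveB_fun (is_derive_cst (0 : R) y 1) (pf_py F tt yr))
      (is_deriveMl_fun e (is_derive_gauss_yy _ _ y t))).
  + exact: (is_deriveB_fun (is_deriveB_fun (is_derive_cst c t 1) (pf_wt F tt yr))
      (is_deriveMl_fun e (is_derive_gauss_t _ _ y t))).
- by move=> t /andP[t0 _]; rewrite (pf_axis F (ltW t0)) mulr0 mul0r mulr0 !subr0.
- move=> t /andP[t0 tT]; have tt := ltW t0; have tt' : 0 <= t <= T by rewrite tt.
  have rt := rpos t tt'.
  have : Phi (r t) t <= 1 by exact: Phi1.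
  rewrite -(ler_pM2l e0) mulr1.
  have E0 : 0 < e * Phi (r t) t by rewrite mulr_gt0.
  have -> : e * (2 * - lam * r t * Phi (r t) t) =
    - (2 * (lam * r t * (e * Phi (r t) t))) by ring.
  set E := e * Phi (r t) t in E0 *; clearbody E => Ee /eqP; rewrite subr_eq0 => /eqP wE.
  rewrite (pf_neumann F tt) sub0r !opprK.
  have wc : w (r t) t < c by lra.
  (* Since [wS1] vanishes at [c], its size at the boundary height is at most [L * E]; the barrier
     slope [2 * lam * r t * E] is larger. *)
  have [|x /andP[wx xc] Ex] := @mvt _ wS1 wS2 _ _ wc.
    by move=> x _; exact: (pf_wS1 F).
  have : `|wS2 x| <= L by apply: HL; lra.
  move: Ex; rewrite c_crit sub0r wE ler_norml => Ex /andP[_].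
  rewrite -(ler_pM2r E0) -Ex.
  have : L * E <= lam * r t * E by rewrite ler_pM2r// lam_rho ler_pM2l// Hrho.
  have : 0 < lam * r t * E by rewrite !mulr_gt0.
  lra.
- move=> y t /andP[t0 tT] /andP[y0 yr] _; have tt := ltW t0.
  have E0 : 0 < e * Phi y t by rewrite mulr_gt0.
  have -> : e * (2 * - lam * y * Phi y t) = - (2 * lam * y * (e * Phi y t)) by ring.
  have -> : e * ((2 * - lam + 4 * (- lam) ^+ 2 * y ^+ 2) * Phi y t) =
    - (2 * lam * (e * Phi y t)) + 4 * (lam * y) ^+ 2 * (e * Phi y t) by ring.
  have -> : e * (- K * Phi y t) = - (K * (e * Phi y t)) by ring.
  set E := e * Phi y t in E0 *; clearbody E.
  rewrite opprK => py qy; have {}py : p y t = 2 * lam * y * E by lra.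
  have lE : 0 < lam * E by rewrite mulr_gt0.
  have mlE : 0 < m * lam * E by rewrite !mulr_gt0.
  have {}qy : q y t <= 2 * (lam * E).
    have := mulr_ge0 (sqr_ge0 (lam * y)) (ltW E0); lra.
  move: y0; rewrite le_eqVlt => /orP[/eqP y00|y_gt0].
    move: qy; rewrite -y00 (pde_axis F tt) => qy.
    have := ler_wpM2l (ltW m_gt0) qy; rewrite /K; lra.
  rewrite (pf_pde F tt) ?y_gt0// py.
  have -> : m * (2 * lam * y * E / y) = 2 * (m * lam * E) by field; exact: lt0r_neq0.
  set a := 1 + _; have a1 : 1 <= a by rewrite lerDl sqr_ge0.
  have a0 : 0 < a by exact: lt_le_trans a1.
  have : q y t / a <= 2 * (lam * E).
    rewrite ler_pdivrMr//; apply: le_trans qy _.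
    by rewrite ler_peMr// mulr_ge0// ltW.
  rewrite /K; lra.
- by rewrite rT lexx.
Qed.

(** * Convergence to the first critical height above the initial boundary *)

Section Convergence.
Variable c : R.
Hypothesis b0_lt_c : b 0 < c.
Hypothesis c_crit : wS1 c = 0.
Hypothesis wS1_lt0 : forall z, b 0 <= z < c -> wS1 z < 0.

Lemma boundary_exceeds c' : c' < c -> exists2 t, 0 <= t & c' < b t.
Proof.
move=> c'c; apply: contrapT => noT.
have ble t : 0 <= t -> b t <= c'.
  by move=> t0; rewrite leNgt; apply/negP => bt; apply: noT; exists t.
have W1c : {within `[b 0, c'], continuous wS1}.
  by apply: continuous_subspaceT => x; exact: is_derive1_continuous (pf_wS1 F x).
have [d] := EVT_max (ble 0 (lexx 0)) W1c; rewrite in_itv/= => /andP[bd dc'] dmax.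
have d_lt0 : wS1 d < 0 by apply: wS1_lt0; rewrite bd (le_lt_trans dc').
have r00 := pf_r_gt0 F (lexx 0).
(* The boundary slope [2 * k * r t] of the paraboloid is then at most [- wS1 d / 2], strictly below
   the slope [- wS1 (b t)] of the solution. *)
pose k := - wS1 d / (4 * r 0).
have k0 : 0 < k by rewrite divr_gt0 ?oppr_gt0// mulr_gt0.
have kr : 4 * (k * r 0) = - wS1 d by rewrite /k; field; exact: lt0r_neq0.
clearbody k.
have rle t : 0 <= t -> k * r t <= k * r 0 by move=> t0; rewrite ler_pM2l// radius_nincr.
have km : 0 < k * m by rewrite mulr_gt0.
(* [C] lifts the initial graph, which is lowest on the axis, above the paraboloid. By time [T] the
   paraboloid has risen by more than [c' + C], which the bound on [b] forbids. *)
pose C := k * r 0 ^+ 2 - w 0 0 + 1.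
pose T := (`|c' + C| + 1) / (k * m).
have T0 : 0 <= T by rewrite divr_ge0 ?(ltW km)// addr_ge0.
have rT := pf_r_gt0 F T0.
have := @paraboloid_below k C 0 T k0 (lexx 0) T0 _ _ (r T) T.
rewrite T0 !lexx (ltW rT) subr0 [k * m * T]mulrC divfK ?gt_eqF// => /(_ _ _ isT isT) H.
have : k * r T ^+ 2 + (`|c' + C| + 1) < w (r T) T + C.
  apply: H => [y /andP[y0 yr]|t /andP[t0 _] _].
    have yr2 : k * y ^+ 2 <= k * r 0 ^+ 2.
      by rewrite ler_pM2l// ler_pXn2r// nnegrE// ltW.
    have := height_ndecr_y (lexx 0) (lexx 0) y0 yr; rewrite /C; lra.
  have tt := ltW t0; rewrite (pf_neumann F tt).
  have : wS1 (b t) <= wS1 d.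
    apply: dmax; rewrite in_itv/= ble// andbT.
    exact: (boundary_height_ndecr (lexx 0) tt).
  by have := rle t tt; lra.
have := ble T T0; have := ler_norm (c' + C).
have : 0 <= k * r T ^+ 2 by rewrite mulr_ge0 ?sqr_ge0// ltW.
lra.
Qed.

Lemma axis_exceeds e : 0 < e -> exists2 t, 0 <= t & c - e < w 0 t.
Proof.
move=> e0; have [|T1 T10 bT1] := @boundary_exceeds (c - e / 2); first by lra.
have r00 := pf_r_gt0 F (lexx 0).
(* So flat a paraboloid varies by at most [e / 4] over the whole domain. *)
pose k := e / (4 * r 0 ^+ 2).
have k0 : 0 < k by rewrite divr_gt0// mulr_gt0// exprn_gt0.
have kr : k * r 0 ^+ 2 = e / 4 by rewrite /k; field; exact: lt0r_neq0.
clearbody k.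
have kr2 y t : 0 <= t -> 0 <= y <= r t -> k * y ^+ 2 <= e / 4.
  move=> t0 /andP[y0 yr]; rewrite -kr ler_pM2l// ler_pXn2r// ?nnegrE ?(ltW r00)//.
  by rewrite (le_trans yr)// radius_nincr.
have km : 0 < k * m by rewrite mulr_gt0.
pose C := e - w 0 T1.
have r1_gt0 := pf_r_gt0 F T10.
have wc : w 0 T1 < c.
  apply: le_lt_trans (below_critical_height c_crit b0_lt_c T10).
  by apply: height_le_boundary => //; rewrite lexx ltW.
(* The time at which the vertex, lowered by [C], reaches height [c - 3 / 4 * e]. The duration is
   nonnegative because [w 0 T1 < c]. *)
pose T2 := T1 + (c - 3 / 4 * e + C) / (k * m).
have T12 : T1 <= T2.
  by rewrite lerDl; apply: divr_ge0; [rewrite /C; lra|exact: ltW].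
have T20 := le_trans T10 T12.
have r2_gt0 := pf_r_gt0 F T20.
have kT2 : k * m * (T2 - T1) = c - 3 / 4 * e + C.
  by rewrite /T2 [T1 + _]addrC addrK mulrC divfK// gt_eqF.
exists T2 => //.
have := @paraboloid_below k C T1 T2 k0 T10 T12 _ _ 0 T2.
rewrite T12 !lexx (ltW r2_gt0) kT2 expr0n mulr0 add0r => /(_ _ _ isT isT) H.
suff : c - 3 / 4 * e + C < w 0 T2 + C by lra.
apply: H => [y yr|t /andP[tt tT2]].
  have := kr2 _ _ T10 yr; case/andP: yr => y0 yr.
  have := height_ndecr_y T10 (lexx 0) y0 yr; rewrite /C; lra.
(* No contact occurs at the boundary: up to [T2] the lowered paraboloid is at most
   [c - 3 / 4 * e + e / 4], while [b t >= b T1 > c - e / 2]. *)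
have t0 := le_trans T10 (ltW tt).
have := boundary_height_ndecr T10 (ltW tt).
have rr : 0 <= r t <= r t by rewrite lexx ltW// (pf_r_gt0 F t0).
have := kr2 _ _ t0 rr.
have : k * m * (t - T1) <= c - 3 / 4 * e + C.
  by rewrite -kT2 ler_pM2l// lerD2r.
lra.
Qed.

Lemma flow_converges e : 0 < e -> exists2 T, 0 <= T & forall t, T <= t ->
  `|r t - wS c| < e /\ forall y, 0 <= y <= r t -> `|w y t - c| < e.
Proof.
move=> e0.
(* All heights lie between [w 0 T] and [c] after time [T]; closeness within [d] of the boundary
   height yields that of the radius, since [r t = wS (b t)]. *)
have /cvgrPdist_lt /(_ e e0) [d /= d0 Hd] := is_derive1_continuous (pf_wS F c).
have de : 0 < Num.min d e by rewrite lt_min d0.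
have [T T0 wT] := axis_exceeds de; exists T => // t Tt.
have t0 := le_trans T0 Tt; have rt := pf_r_gt0 F t0.
have close y : 0 <= y <= r t -> `|w y t - c| < Num.min d e.
  move=> yr; have bc := below_critical_height c_crit b0_lt_c t0.
  have := le_lt_trans (height_le_boundary t0 yr) bc.
  case/andP: yr => y0 yr; have := height_ndecr_y t0 (lexx 0) y0 yr.
  have := height_ndecr_t (y := 0) T0 Tt; rewrite lexx (ltW rt) => /(_ isT).
  by rewrite ltr_norml; lra.
split=> [|y yr]; last by have := close y yr; rewrite lt_min => /andP[].
rewrite (pf_boundary F t0) distrC; apply: Hd => /=.
have := close (r t); rewrite lexx (ltW rt) => /(_ isT).
by rewrite lt_min distrC => /andP[].
Qed.

End Convergence.
End UpwardFlow.

(** Take the infimum of the points from [x0] on where [f] is nonnegative: continuity gives [f >= 0]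
    there, and negativity on its left gives [f <= 0]. *)
Lemma first_zero (R : realType) (f : R -> R) (x0 : R) : continuous f -> f x0 < 0 ->
  ~ (forall z, x0 <= z -> f z < 0) ->
  exists2 c, x0 < c & f c = 0 /\ forall z, x0 <= z < c -> f z < 0.
Proof.
move=> fc fx0 nonneg.
pose A := [set z | x0 <= z /\ 0 <= f z].
have A0 : A !=set0.
  apply: contrapT => A0; apply: nonneg => z xz; rewrite ltNge; apply/negP => fz.
  by apply: A0; exists z.
have lA : has_lbound A by exists x0 => z [].
have iA : has_inf A by [].
have before z : x0 <= z < inf A -> f z < 0.
  move=> /andP[xz zi]; rewrite ltNge; apply/negP => fz.
  by have := ge_inf lA (conj xz fz : A z); rewrite leNgt zi.
have xinf : x0 <= inf A by apply: lb_le_inf => // z [].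
have fge : 0 <= f (inf A).
  rewrite leNgt; apply/negP => fneg.
  have /cvgrPdist_lt /(_ (- f (inf A))) [|d /= d0 H] := fc (inf A).
    by rewrite oppr_gt0.
  have [z [xz fz] zd] := inf_adherent d0 iA.
  have iz := ge_inf lA (conj xz fz : A z).
  have := H z; rewrite /ball_/= distrC ger0_norm ?subr_ge0//.
  have -> : z - inf A < d by lra.
  by move=> /(_ isT); rewrite ltr_norml; lra.
have xlt : x0 < inf A.
  by rewrite lt_neqAle xinf andbT; apply/eqP => E; move: fge; rewrite -E leNgt fx0.
exists (inf A) => //; split => //.
apply/eqP; rewrite eq_le fge andbT leNgt; apply/negP => fpos.
have /cvgrPdist_lt /(_ (f (inf A)) fpos) [d /= d0 H] := fc (inf A).
pose z := Num.max x0 (inf A - d / 2).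
have zi : z < inf A by rewrite gt_max xlt/=; lra.
have xz : x0 <= z by rewrite le_max lexx.
have zd : inf A - d / 2 <= z by rewrite le_max lexx orbT.
have := before z; rewrite xz zi => /(_ isT).
have := H z; rewrite /ball_/= gtr0_norm ?subr_gt0//.
have -> : inf A - z < d by lra.
by move=> /(_ isT); rewrite ltr_norml; lra.
Qed.

(** Nonnegative velocity makes [wS1 <= 0] at the initial boundary height; noncriticality makes this
    strict, and the end hypothesis then supplies a first critical height above. *)
Theorem upward_convergence (R : realType) (m : R) (wS wS1 wS2 r r1 : R -> R)
  (w p q v vy vyy vt : R -> R -> R) : 0 < m ->
  profile_flow m wS wS1 wS2 r r1 w p q v vy vyy vt ->
  (forall y, 0 <= y <= r 0 -> 0 <= v y 0) ->
  wS1 (w (r 0) 0) != 0 ->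
  (forall z0, ~ (forall z, z0 <= z -> wS1 z < 0)) ->
  exists2 c, w (r 0) 0 < c &
    [/\ wS1 c = 0, forall z, w (r 0) 0 <= z < c -> wS1 z < 0 &
      forall e, 0 < e -> exists2 T, 0 <= T & forall t, T <= t ->
        `|r t - wS c| < e /\ forall y, 0 <= y <= r t -> `|w y t - c| < e].
Proof.
move=> m0 F v_init W1 endc.
have v0 := velocity_ge0 m0 F v_init.
have W1lt0 : wS1 (w (r 0) 0) < 0 by rewrite lt_neqAle W1 (boundary_slope_le0 m0 F v0).
have W1c : continuous wS1 by move=> x; exact: is_derive1_continuous (pf_wS1 F x).
have [c bc [c_crit cneg]] := first_zero W1c W1lt0 (endc _).
exists c => //; split => //.
exact: (flow_converges m0 F v0 bc c_crit cneg).
Qed.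

(** * From solutions of (P) to profile flows *)

Section SmoothFunctions.
Variables (R : realType) (U : set (R * R)).
Hypothesis oU : open U.
Implicit Types (f : R -> R -> R) (y t : R).

(** All orders at once, so that the class is stable under [Dy] and [Dt]. *)
Definition smooth_on f := forall k, Ck k U f.

Lemma smooth_on_Dy f : smooth_on f -> smooth_on (Dy f).
Proof. by move=> sf k; have [_ []] := sf k.+1. Qed.

Lemma smooth_on_Dt f : smooth_on f -> smooth_on (Dt f).
Proof. by move=> sf k; have [_ []] := sf k.+1. Qed.

Lemma smooth_on_cts2 f y t : smooth_on f -> U (y, t) -> cts2 f y t.
Proof. by move=> sf Uyt; apply: cts2P; have [+ _] := sf 0; apply. Qed.

Lemma smooth_on_is_derive_y f y t : smooth_on f -> U (y, t) ->
  is_derive y 1 (f^~ t) (Dy f y t).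
Proof.
move=> sf Uyt; apply: derivable_is_derive.
have [_ [D _ _]] := sf 1; exact: (D (y, t) Uyt).1.
Qed.

Lemma smooth_on_is_derive_t f y t : smooth_on f -> U (y, t) ->
  is_derive t 1 (f y) (Dt f y t).
Proof.
move=> sf Uyt; apply: derivable_is_derive.
have [_ [D _ _]] := sf 1; exact: (D (y, t) Uyt).2.
Qed.

Lemma smooth_on_mixed f y t : smooth_on f -> U (y, t) ->
  Dt (Dy f) y t = Dy (Dt f) y t.
Proof.
move=> sf Uyt; have [d d0 H] := open2P oU Uyt.
have sy := smooth_on_Dy sf; have st := smooth_on_Dt sf.
apply: (@mixed_partials R f (Dy f) (Dt f) (Dt (Dy f)) (Dy (Dt f)) y t d d0).
- move=> y' t' yy tt; have U' := H y' t' yy tt; split.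
  + exact: smooth_on_is_derive_y.
  + exact: smooth_on_is_derive_t.
  + exact: smooth_on_is_derive_t.
  + exact: smooth_on_is_derive_y.
- by apply: smooth_on_cts2 => //; exact: smooth_on_Dt.
- by apply: smooth_on_cts2 => //; exact: smooth_on_Dy.
Qed.

(** Two exchanges: one for [Dy f] at the point, then one for [f] on a whole neighbourhood, because
    the outer [Dy] differentiates that identity. *)
Lemma smooth_on_mixed2 f y t : smooth_on f -> U (y, t) ->
  Dt (Dy (Dy f)) y t = Dy (Dy (Dt f)) y t.
Proof.
move=> sf Uyt; rewrite (smooth_on_mixed (smooth_on_Dy sf) Uyt).
have [d d0 H] := open2P oU Uyt.
have sty : smooth_on (Dt (Dy f)) by apply/smooth_on_Dt/smooth_on_Dy.
apply/esym/is_derive1_derive1; apply: (is_derive1_near d0); last first.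
  exact: (smooth_on_is_derive_y sty Uyt).
by move=> s sy /=; apply: smooth_on_mixed sf _; apply: H; rewrite ?subrr ?normr0.
Qed.

Lemma smooth_on_along f g dg t : smooth_on f -> U (g t, t) -> is_derive t 1 g dg ->
  is_derive t 1 (fun s => f (g s) s) (Dy f (g t) t * dg + Dt f (g t) t).
Proof.
move=> sf Ugt gD; have [d d0 H] := open2P oU Ugt.
apply: (is_derive_along d0 _ _ _ gD).
- by move=> y s yy ss; apply: smooth_on_is_derive_y => //; exact: H.
- by apply: smooth_on_cts2 => //; exact: smooth_on_Dy.
- exact: smooth_on_is_derive_t.
Qed.

End SmoothFunctions.

Lemma within_at_right (R : realType) (f g : R -> R) (e l : R) : 0 < e ->
  (forall x, 0 < x < e -> f x = g x) ->
  g x @[x --> 0^'+] --> l -> f x @[x --> 0^'+] --> l.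
Proof.
move=> e0 fg; apply: cvg_trans; apply: near_eq_cvg; near=> x; apply/esym/fg.
by apply/andP; split; near: x; [exact: nbhs_right_gt|exact: nbhs_right_lt].
Unshelve. all: by end_near. Qed.

(** The two normalising factors are positive and cancel, leaving an orthogonality relation linear in
    the slopes. *)
Lemma neumann_slope (R : realType) (wS f : R -> R) (y : R) :
  dot2 (nu_graph f y) (nuSigma wS (f y)) = 0 ->
  derive1 f y = - derive1 wS (f y).
Proof.
rewrite /dot2 /nu_graph /nuSigma /=.
set a := (Num.sqrt _)^-1; set b := (Num.sqrt _)^-1.
have W0 (x : R) : 0 < (Num.sqrt (1 + x ^+ 2))^-1.
  by rewrite invr_gt0 sqrtr_gt0 ltr_pwDl// sqr_ge0.
have a0 : a != 0 by rewrite gt_eqF// W0.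
have b0 : b != 0 by rewrite gt_eqF// W0.
have -> : - (a * derive1 f y) * b + a * - (b * derive1 wS (f y)) =
  - (a * b) * (derive1 f y + derive1 wS (f y)) by ring.
move/eqP; rewrite mulf_eq0 oppr_eq0 mulf_eq0 (negPf a0) (negPf b0)/=.
by rewrite addr_eq0 => /eqP.
Qed.

(** Smoothness for [t > 0] provides the derivatives of the velocity and the exchange of partials;
    what is needed at [t = 0] comes from [sol_derivable] and [sol_cont]. *)
Lemma global_solution_profile (R : realType) (n : nat) (wS : R -> R)
  (r0 : R) (w0 r : R -> R) (w : R -> R -> R) :
  smooth1 wS -> global_solution n wS r0 w0 r w ->
  profile_flow (n%:R - 1) wS (derive1 wS) (derive1 (derive1 wS)) r (derive1 r)
    w (Dy w) (Dy (Dy w)) (Dt w) (Dy (Dt w)) (Dy (Dy (Dt w))) (Dt (Dt w)).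
Proof.
move=> sS sol; have [U [oU DU sU]] := sol_smooth sol.
have [wc pc qc vc] := sol_cont sol.
have sw : smooth_on U w := sU.
have sp := smooth_on_Dy sw; have sv := smooth_on_Dt sw.
have sq := smooth_on_Dy sp; have svy := smooth_on_Dy sv.
have svt := smooth_on_Dt sv; have svyy := smooth_on_Dy svy.
have inU y t : 0 < t -> 0 <= y <= r t -> U (y, t).
  by move=> t0 yr; apply: DU; split => //; split => //=; exact: ltW.
have bU t : 0 < t -> U (r t, t).
  by move=> t0; apply: inU => //; rewrite lexx ltW// (sol_r_gt0 sol)// ltW.
have aU t : 0 < t -> U (0, t).
  by move=> t0; apply: inU => //; rewrite lexx ltW// (sol_r_gt0 sol)// ltW.
have wS1D (z : R) : is_derive z 1 (derive1 wS) (derive1 (derive1 wS) z).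
  by apply: derivable_is_derive; have := sS 1%N z; rewrite derive1n1.
have rD (t : R) : 0 < t -> is_derive t 1 r (derive1 r t).
  move=> t0; apply: derivable_is_derive.
  by have := sol_r_smooth sol (k := 0%N) t0; rewrite derive1n0.
have D (y t : R) : 0 <= t -> 0 <= y <= r t ->
  [/\ derivable (fun s => w s t) y 1, derivable (fun s => Dy w s t) y 1
     & derivable (w y) t 1].
  by move=> t0 yr; exact: (sol_derivable sol).
split.
- by move=> z; apply: derivable_is_derive; have := sS 0%N z; rewrite derive1n0.
- exact: wS1D.
- move=> z; apply: (@is_derive1_continuous _ _ _ (derive1 (derive1 (derive1 wS)) z)).
  apply: derivable_is_derive; have := sS 2%N z.
  by rewrite derive1nS derive1n1.
- by move=> t t0; exact: (sol_r_gt0 sol).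
- exact: (sol_r_cont sol).
- exact: rD.
- exact: wc.
- exact: pc.
- exact: qc.
- exact: vc.
- by move=> y t t0 /(D y t t0)[+ _ _]; exact: derivable_is_derive.
- by move=> y t t0 /(D y t t0)[_ + _]; exact: derivable_is_derive.
- by move=> y t t0 /(D y t t0)[_ _ +]; exact: derivable_is_derive.
- move=> y t t0 yr; rewrite -(smooth_on_mixed oU sw (inU y t t0 yr)).
  exact: (smooth_on_is_derive_t sp (inU y t t0 yr)).
- move=> y t t0 yr; rewrite -(smooth_on_mixed2 oU sw (inU y t t0 yr)).
  exact: (smooth_on_is_derive_t sq (inU y t t0 yr)).
- by move=> y t t0 yr; exact: (smooth_on_is_derive_y sv (inU y t t0 yr)).
- by move=> y t t0 yr; exact: (smooth_on_is_derive_y svy (inU y t t0 yr)).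
- by move=> y t t0 yr; exact: (smooth_on_is_derive_t sv (inU y t t0 yr)).
- by move=> t t0; exact: (is_derive1_continuous (smooth_on_is_derive_y svyy (aU t t0))).
- by move=> t t0; exact: (is_derive1_continuous (smooth_on_is_derive_y svt (aU t t0))).
- by move=> t t0; exact: (smooth_on_along oU sw (bU t t0) (rD t t0)).
- move=> t t0; rewrite -(smooth_on_mixed oU sw (bU t t0)).
  exact: (smooth_on_along oU sp (bU t t0) (rD t t0)).
- move=> y t t0 yr; rewrite (sol_pde sol t0 yr) mul1r.
  by congr +%R; rewrite mulrCA.
- by move=> t t0; exact: (sol_boundary sol).
- by move=> t t0; exact: (neumann_slope (sol_neumann sol t0)).
(* A finite limit of [w_y / y] forces [w_y] to tend to 0, and continuity identifies this limit with
   the value on the axis. *)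
- move=> t t0; have [l Hl] := sol_axis sol t0; have rt := sol_r_gt0 sol t0.
  have /continuous_within_itvP-/(_ rt)[_ pr _] := within_slice t0 pc.
  apply: (cvg_unique _ pr) => //.
  apply: (@within_at_right _ _ (fun y => y * (y^-1 * Dy w y t)) (r t)) => //.
    by move=> y /andP[y0 _]; rewrite mulVKf// gt_eqF.
  rewrite -[X in _ --> X](mul0r l); apply: cvgM => //.
  exact: cvg_at_right_filter cvg_id.
Qed.

(** The equation is odd in [(v, p, q)]: reflection negates the height and its derivatives and keeps
    the radius. This reduces case (b) to case (a). *)
Lemma profile_flow_reflection (R : realType) (m : R) (wS wS1 wS2 r r1 : R -> R)
  (w p q v vy vyy vt : R -> R -> R) :
  profile_flow m wS wS1 wS2 r r1 w p q v vy vyy vt ->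
  profile_flow m (fun z => wS (- z)) (fun z => - wS1 (- z)) (fun z => wS2 (- z)) r r1
    (fun y t => - w y t) (fun y t => - p y t) (fun y t => - q y t)
    (fun y t => - v y t) (fun y t => - vy y t) (fun y t => - vyy y t)
    (fun y t => - vt y t).
Proof.
move=> F.
have cN (A : set (R * R)) (f : R -> R -> R) : {within A, continuous (jointly f)} ->
    {within A, continuous (jointly (fun y t => - f y t))}.
  by move=> fc x; apply: cvgN; exact: fc.
split.
- by move=> z; apply: is_derive_reflect; exact: (pf_wS F).
- move=> z; rewrite -[wS2 _]opprK; apply: is_deriveN_fun.
  by apply: is_derive_reflect; exact: (pf_wS1 F).
- by move=> z; apply: continuous_comp; [exact: opp_continuous|exact: (pf_wS2 F)].
- exact: (pf_r_gt0 F).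
- exact: (pf_r_cont F).
- exact: (pf_r1 F).
- exact: (cN _ _ (pf_w_cont F)).
- exact: (cN _ _ (pf_p_cont F)).
- exact: (cN _ _ (pf_q_cont F)).
- exact: (cN _ _ (pf_v_cont F)).
- by move=> y t t0 yr; exact: (is_deriveN_fun (pf_wy F t0 yr)).
- by move=> y t t0 yr; exact: (is_deriveN_fun (pf_py F t0 yr)).
- by move=> y t t0 yr; exact: (is_deriveN_fun (pf_wt F t0 yr)).
- by move=> y t t0 yr; exact: (is_deriveN_fun (pf_pt F t0 yr)).
- by move=> y t t0 yr; exact: (is_deriveN_fun (pf_qt F t0 yr)).
- by move=> y t t0 yr; exact: (is_deriveN_fun (pf_vy F t0 yr)).
- by move=> y t t0 yr; exact: (is_deriveN_fun (pf_vyy F t0 yr)).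
- by move=> y t t0 yr; exact: (is_deriveN_fun (pf_vt F t0 yr)).
- by move=> t t0; apply: cvgN; exact: (pf_vyy_axis F t0).
- by move=> t t0; apply: cvgN; exact: (pf_vt_axis F t0).
- by move=> t t0; rewrite mulNr -opprD; exact: (is_deriveN_fun (pf_w_boundary_t F t0)).
- by move=> t t0; rewrite mulNr -opprD; exact: (is_deriveN_fun (pf_p_boundary_t F t0)).
- by move=> y t t0 yr; rewrite (pf_pde F t0 yr) sqrrN !mulNr mulrN opprD.
- by move=> t t0; rewrite opprK; exact: (pf_boundary F).
- by move=> t t0; rewrite (pf_neumann F t0) !opprK.
- by move=> t t0; rewrite (pf_axis F t0) oppr0.
Qed.

(** * Mean curvature of a radial graph *)

Section RadialGraph.
Variables (R : realType) (n : nat).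
Implicit Types (x : 'rV[R]_n) (f : R -> R).

Lemma enorm_ge0 x : 0 <= enorm x. Proof. exact: sqrtr_ge0. Qed.

Lemma sqr_enorm x : enorm x ^+ 2 = \sum_i x ord0 i ^+ 2.
Proof. by rewrite sqr_sqrtr// sumr_ge0// => i _; exact: sqr_ge0. Qed.

Lemma enorm0 : enorm (0 : 'rV[R]_n) = 0.
Proof.
rewrite /enorm big1 ?sqrtr0// => i _.
by rewrite mxE expr0n.
Qed.

Lemma enormZ k x : enorm (k *: x) = `|k| * enorm x.
Proof.
rewrite /enorm; under eq_bigr do rewrite mxE exprMn.
by rewrite -mulr_sumr sqrtrM ?sqr_ge0// sqrtr_sqr.
Qed.

Lemma enorm_line x (i : 'I_n) (h : R) :
  enorm (h *: dirvec R i + x) = Num.sqrt (enorm x ^+ 2 + 2 * x ord0 i * h + h ^+ 2).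
Proof.
rewrite sqr_enorm /enorm (bigD1 i)//= [in RHS](bigD1 i)//= !mxE !eqxx mulr1.
under eq_bigr => j ji do rewrite !mxE (negPf ji) andbF mulr0 add0r.
by congr Num.sqrt; ring.
Qed.

Lemma derive_line (f : 'rV[R]_n -> R) (v a : 'rV[R]_n) (d : R) :
  is_derive (0 : R) 1 (fun h => f (h *: v + a)) d -> 'D_v f a = d.
Proof.
move=> [D E]; apply: cvg_lim => //.
have : h^-1 *: (f ((h *: 1 + 0) *: v + a) - f (0 *: v + a)) @[h --> (0 : R)^'] --> d.
  by rewrite -E; exact: D.
apply: cvg_trans; apply: near_eq_cvg; near=> h.
by rewrite scale0r add0r addr0 [h *: 1]mulr1.
Unshelve. all: by end_near. Qed.

Lemma is_derive_enorm_line x (i : 'I_n) : 0 < enorm x ->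
  is_derive (0 : R) 1 (fun h => enorm (h *: dirvec R i + x)) (x ord0 i / enorm x).
Proof.
move=> x0; have x2 : 0 < enorm x ^+ 2 by rewrite exprn_gt0.
under eq_fun do rewrite enorm_line.
have D : is_derive (0 : R) 1 (fun h : R => enorm x ^+ 2 + 2 * x ord0 i * h + h ^+ 2)
    (2 * x ord0 i).
  have := is_deriveD_fun (is_derive_affine (2 * x ord0 i) (enorm x ^+ 2) 0)
    (is_derive_square 1 0).
  rewrite mulr0 addr0; under eq_fun do rewrite mul1r [_ * _ + _]addrC.
  exact.
set g := (fun h : R => _) in D.
have g0 : g 0 = enorm x ^+ 2 by rewrite /g expr0n mulr0 !addr0.
have Ds : is_derive (g 0) 1 Num.sqrt (2 * Num.sqrt (enorm x ^+ 2))^-1.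
  by rewrite g0; exact: is_derive1_sqrt.
apply: (is_derive_eq (is_derive1_comp Ds D)).
by rewrite sqrtr_sqr gtr0_norm//; field; exact: lt0r_neq0.
Qed.

(** Near [x] a coordinate line avoids the axis and the boundary, so radial formulas may be
    substituted under an outer derivative. *)
Lemma enorm_line_near x (i : 'I_n) (rho : R) : 0 < enorm x < rho ->
  exists2 e, 0 < e & forall h, `|h| < e -> 0 < enorm (h *: dirvec R i + x) < rho.
Proof.
move=> /andP[x0 xr].
have := is_derive1_continuous (is_derive_enorm_line i x0).
move=> /cvgrPdist_lt /(_ (Num.min (enorm x) (rho - enorm x))) [].
  by rewrite lt_min x0 subr_gt0.
move=> e /= e0 H; exists e => // h he.
have := H h; rewrite /ball_/= sub0r normrN => /(_ he).
by rewrite scale0r add0r lt_min !ltr_norml; lra.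
Qed.

Section Curvature.
Variables (f f1 f2 : R -> R) (rho : R).
Hypothesis fD : forall s, 0 < s < rho -> is_derive s 1 f (f1 s).
Hypothesis f1D : forall s, 0 < s < rho -> is_derive s 1 f1 (f2 s).

Local Notation u := (fun x : 'rV[R]_n => f (enorm x)).

Lemma radial_partial x (i : 'I_n) : 0 < enorm x < rho ->
  'D_(dirvec R i) u x = f1 (enorm x) * (x ord0 i / enorm x).
Proof.
move=> xr; apply: derive_line.
apply: (@is_derive1_comp R f (fun h => enorm (h *: dirvec R i + x))).
  by rewrite scale0r add0r; exact: fD.
by apply: is_derive_enorm_line; case/andP: xr.
Qed.

Lemma radial_grad_sq x : 0 < enorm x < rho -> grad_sq u x = f1 (enorm x) ^+ 2.
Proof.
move=> xr; rewrite /grad_sq.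
under eq_bigr do rewrite radial_partial// exprMn expr_div_n.
rewrite -mulr_sumr -mulr_suml -sqr_enorm divff ?mulr1//.
by rewrite expf_neq0// gt_eqF//; case/andP: xr.
Qed.

Lemma radial_mean_curvature x : 0 < enorm x < rho ->
  mean_curvature f x =
    - (f2 (enorm x) / (1 + f1 (enorm x) ^+ 2)
       + f1 (enorm x) * ((n%:R - 1) / enorm x))
    / Num.sqrt (1 + f1 (enorm x) ^+ 2).
Proof.
move=> xr; have /andP[x0 _] := xr.
pose W (s : R) := Num.sqrt (1 + f1 s * f1 s).
(* The flux vector is [G] of the radius times [x]; its divergence is [s * dG + n * G s]. *)
pose G (s : R) := f1 s * (s^-1 * (W s)^-1).
set s := enorm x in xr x0 *.
have W2_gt0 t : 0 < 1 + f1 t * f1 t by rewrite ltr_pwDl// -expr2 sqr_ge0.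
have W_gt0 t : 0 < W t by rewrite sqrtr_gt0.
have W_neq0 : W s != 0 by exact: lt0r_neq0.
have s_neq0 : s != 0 by exact: lt0r_neq0.
have WW : W s ^+ 2 = 1 + f1 s * f1 s by rewrite sqr_sqrtr// ltW.
have WD : is_derive s 1 W (f1 s * f2 s / W s).
  have D : is_derive s 1 (fun t => 1 + f1 t * f1 t) (0 + (f2 s * f1 s + f1 s * f2 s)).
    by apply: is_deriveD_fun; exact: is_deriveM_fun (f1D xr) (f1D xr).
  apply: (is_derive_eq (@is_derive1_comp _ Num.sqrt (fun t => 1 + f1 t * f1 t) _ _ _
    (is_derive1_sqrt (W2_gt0 s)) D)).
  by rewrite -/(W s); field.
pose dG := f2 s / (s * W s) - f1 s / (s ^+ 2 * W s) - f1 s ^+ 2 * f2 s / (s * W s ^+ 3).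
have GD : is_derive s 1 G dG.
  have D1 := is_deriveV_fun (f := id) s_neq0 (is_derive_id s 1).
  have D2 := is_deriveV_fun (f := W) W_neq0 WD.
  apply: (is_derive_eq (is_deriveM_fun (f1D xr) (is_deriveM_fun D1 D2))).
  by rewrite /dG /=; field; rewrite W_neq0 s_neq0.
have flux (i : 'I_n) : 'D_(dirvec R i)
    (fun x' => 'D_(dirvec R i) u x' / Num.sqrt (1 + grad_sq u x')) x =
    dG * (x ord0 i ^+ 2 / s) + G s.
  have [e e0 H] := enorm_line_near i xr.
  apply: derive_line.
  apply: (@is_derive1_near _
    (fun h => G (enorm (h *: dirvec R i + x)) * (1 * h + x ord0 i)) _ _ _ e e0).
    move=> h; rewrite subr0 => /H hr.
    rewrite radial_partial// radial_grad_sq// !mxE !eqxx /G /W -expr2 mulr1 mul1r.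
    ring.
  have Dn : is_derive (0 : R) 1 (fun h => G (enorm (h *: dirvec R i + x))) (dG * (x ord0 i / s)).
    apply: (@is_derive1_comp R G (fun h => enorm (h *: dirvec R i + x))).
      by rewrite scale0r add0r.
    exact: is_derive_enorm_line.
  apply: (is_derive_eq (is_deriveM_fun Dn (is_derive_affine 1 (x ord0 i) 0))).
  by rewrite scale0r add0r -/s; ring.
rewrite /mean_curvature /graph_mean_curvature.
under eq_bigr do rewrite flux.
rewrite big_split/= sumr_const card_ord -mulr_sumr -mulr_suml -sqr_enorm -/s.
have -> : Num.sqrt (1 + f1 s ^+ 2) = W s by rewrite /W -expr2.
have -> : 1 + f1 s ^+ 2 = W s ^+ 2 by rewrite WW expr2.
have f1W : f1 s ^+ 2 = W s ^+ 2 - 1 by rewrite WW expr2; ring.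
rewrite -mulr_natl /dG /G f1W.
by field; rewrite W_neq0 s_neq0.
Qed.

End Curvature.
End RadialGraph.

(** The equation at time 0 identifies the numerator of the radial curvature formula; derivatives of
    [w] and [w0] agree there because the functions agree on an open interval. *)
Lemma initial_velocity (R : realType) (n : nat) (wS : R -> R) (r0 : R)
  (w0 r : R -> R) (w : R -> R -> R) : C2_on [set y | 0 < y < r0] w0 ->
  global_solution n wS r0 w0 r w ->
  forall x : 'rV[R]_n, 0 < enorm x < r0 ->
    mean_curvature w0 x = - Dt w (enorm x) 0 / Num.sqrt (1 + derive1 w0 (enorm x) ^+ 2).
Proof.
move=> C2 sol x xr.
have D1 s : 0 < s < r0 -> is_derive s 1 w0 (derive1 w0 s).
  by move=> /C2[+ _ _]; exact: derivable_is_derive.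
have D2 s : 0 < s < r0 -> is_derive s 1 (derive1 w0) (derive1 (derive1 w0) s).
  by move=> /C2[_ + _]; exact: derivable_is_derive.
rewrite (radial_mean_curvature D1 D2 xr); congr (- _ / _).
have xr0 : 0 < enorm x < r 0 by rewrite (sol_r_init sol).
rewrite (sol_pde sol (lexx 0) xr0).
have near0 s : 0 < s < r0 -> exists2 e, 0 < e & forall s', `|s' - s| < e -> 0 < s' < r0.
  move=> /andP[s0 sr]; exists (Num.min s (r0 - s)); first by rewrite lt_min s0 subr_gt0.
  by move=> s'; rewrite lt_min !ltr_norml; lra.
have E1 s : 0 < s < r0 -> Dy w s 0 = derive1 w0 s.
  move=> sr; have [e e0 H] := near0 s sr; apply: is_derive1_derive1.
  apply: (is_derive1_near e0 _ (D1 s sr)) => s' /H s'r.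
  by rewrite (sol_init sol).
have E2 s : 0 < s < r0 -> Dy (Dy w) s 0 = derive1 (derive1 w0) s.
  move=> sr; have [e e0 H] := near0 s sr; apply: is_derive1_derive1.
  apply: (is_derive1_near e0 _ (D2 s sr)) => s' /H s'r.
  by rewrite E1.
by rewrite E1// E2// div1r.
Qed.

(** * Limit disks *)

Section Limits.
Variables (R : realType) (n : nat).
Implicit Types (x : 'rV[R]_n) (p q : 'rV[R]_n * R) (wS r : R -> R) (w : R -> R -> R).

Lemma edist_lt p q (e : R) : enorm (p.1 - q.1) < e / 2 -> `|p.2 - q.2| < e / 2 ->
  Defs.edist p q < e.
Proof.
move=> h1 h2; have a0 := enorm_ge0 (p.1 - q.1).
have e0 : 0 < e by lra.
rewrite /Defs.edist -[ltRHS](ger0_norm (ltW e0)) -[`|e|]sqrtr_sqr ltr_sqrt ?exprn_gt0//.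
rewrite -(real_normK (num_real (p.2 - q.2))).
have b0 := normr_ge0 (p.2 - q.2).
set a := enorm _ in a0 h1 *; set b := `|_| in b0 h2 *.
have A : a ^+ 2 <= (e / 2) ^+ 2 by rewrite ler_pXn2r ?nnegrE//; lra.
have B : b ^+ 2 <= (e / 2) ^+ 2 by rewrite ler_pXn2r ?nnegrE//; lra.
have : 0 < e ^+ 2 by rewrite exprn_gt0.
by move: A B; rewrite expr_div_n; lra.
Qed.

Lemma height_le_edist p q : `|p.2 - q.2| <= Defs.edist p q.
Proof. by rewrite -sqrtr_sqr ler_sqrt ?lerDr ?sqr_ge0// addr_ge0// sqr_ge0. Qed.

(** Matches points over a ball of radius [r t] with points of a disk of radius [wS c], in both
    directions of the Hausdorff estimate. *)
Lemma rescale x (a b : R) : 0 < a -> 0 < b -> enorm x <= a ->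
  enorm ((b / a) *: x) <= b /\ enorm (x - (b / a) *: x) <= `|a - b|.
Proof.
move=> a0 b0 xa; have a_neq0 : a != 0 by exact: lt0r_neq0.
split.
  rewrite enormZ gtr0_norm ?divr_gt0//.
  by rewrite -[leRHS](divfK a_neq0) ler_pM2l ?divr_gt0.
rewrite -[X in X - _]scale1r -scalerBl enormZ.
have -> : 1 - b / a = (a - b) / a by field.
rewrite normf_div (gtr0_norm a0) -[leRHS](divfK a_neq0).
by rewrite ler_wpM2l// divr_ge0// ltW.
Qed.

Lemma converges_to_disk wS r w (c : R) : 0 < wS c ->
  (forall t, 0 <= t -> 0 < r t) ->
  (forall e, 0 < e -> exists2 T, 0 <= T & forall t, T <= t ->
     `|r t - wS c| < e /\ forall y, 0 <= y <= r t -> `|w y t - c| < e) ->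
  converges_to (flow_at n r w) (disk n wS c).
Proof.
move=> wc0 r0 lim e e0.
have [T T0 HT] := lim (e / 2) (divr_gt0 e0 (ltr0Sn R 1)).
exists T; split; first exact: num_real.
move=> t /ltW Tt; have [rt wt] := HT t Tt.
have rt0 : 0 < r t by apply: r0; exact: le_trans Tt.
split=> [_ [x /= xr <-]|[x z] [/= xc zc]].
  have [k1 k2] := rescale rt0 wc0 xr.
  exists ((wS c / r t) *: x, c) => //; apply: edist_lt => /=.
    exact: le_lt_trans k2 rt.
  by apply: wt; rewrite enorm_ge0.
have [k1 k2] := rescale wc0 rt0 xc.
pose x' := (r t / wS c) *: x.
exists (x', w (enorm x') t); first by exists x'.
apply: edist_lt => /=.
  have -> : x' - x = -1 *: (x - x') by rewrite scaleN1r opprB.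
  by rewrite enormZ normrN1 mul1r (le_lt_trans k2)// distrC.
by rewrite zc; apply: wt; rewrite enorm_ge0.
Qed.

(** At a late common time the axis point of the flow is closer than half of the distance between [z]
    and [z'] to both disks. *)
Lemma limit_disk_unique wS r w (z z' : R) : (forall t, 0 <= t -> 0 < r t) ->
  converges_to (flow_at n r w) (disk n wS z) ->
  converges_to (flow_at n r w) (disk n wS z') -> z' = z.
Proof.
move=> r0 lim lim'; apply/eqP; rewrite -subr_eq0 -normr_le0 leNgt; apply/negP => e0.
have e20 := divr_gt0 e0 (ltr0Sn R 1).
have [M [_ HM]] := lim _ e20; have [M' [_ HM']] := lim' _ e20.
pose t := Num.max 0 (Num.max M M') + 1.
have t0 : 0 <= t by rewrite ler_wpDr// le_max lexx.
have Mt : M < t by rewrite ltr_pwDr// !le_max lexx orbT.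
have M't : M' < t by rewrite ltr_pwDr// !le_max lexx !orbT.
have [H _] := HM t Mt; have [H' _] := HM' t M't.
have Mp : flow_at n r w t (0, w (enorm (0 : 'rV[R]_n)) t).
  by exists 0 => //=; rewrite enorm0 ltW// r0.
have [q [_ qz] pq] := H _ Mp; have [q' [_ qz'] pq'] := H' _ Mp.
have := le_lt_trans (height_le_edist _ _) pq; rewrite qz.
have := le_lt_trans (height_le_edist _ _) pq'; rewrite qz'/= distrC.
set h := w _ t => A B.
have := ler_normD (z' - h) (h - z); rewrite addrA subrK; lra.
Qed.

End Limits.

(** * The profile at its two ends, and its reflection *)

Section Ends.
Variable R : realType.
Implicit Types f : R -> R.

Lemma smooth1_is_derive f (z : R) : smooth1 f -> is_derive z 1 f (derive1 f z).
Proof. by move=> sf; apply: derivable_is_derive; have := sf 0%N z; rewrite derive1n0. Qed.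

Lemma decreasing_lt f (f1 : R -> R) (a b : R) : (forall z : R, is_derive z 1 f (f1 z)) ->
  a < b -> (forall z, a <= z < b -> f1 z < 0) -> f b < f a.
Proof.
move=> fD ab f1neg; have [c /andP[ac cb] E] := mvt ab (fun x _ => fD x).
by rewrite -subr_lt0 E pmulr_llt0 ?subr_gt0// f1neg// ltW.
Qed.

(** A positive function decreasing up to infinity converges to its infimum, against (i), and (ii)
    makes the derivative positive far out. *)
Lemma not_decreasing_to_pinfty f (z0 : R) : smooth1 f -> (forall z, 0 < f z) ->
  end_condition_pinfty f -> ~ (forall z, z0 <= z -> derive1 f z < 0).
Proof.
move=> sf f0 fend fneg.
have fD (z : R) := smooth1_is_derive z sf.
case: fend => [nolim|[a a0 fa]]; last first.
  pose z := Num.max z0 a + 1.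
  have az : a < z by rewrite ltr_pwDr// le_max lexx orbT.
  have zz : z0 <= z by rewrite ler_wpDr// le_max lexx.
  have := fa z az; rewrite (pmulr_rgt0 _ (lt_trans a0 az)).
  by rewrite ltNge ltW// fneg.
apply: nolim.
pose A := f @` [set z | z0 <= z].
have lA : has_lbound A by exists 0 => _ [z _ <-]; exact: ltW.
have iA : has_inf A by split => //; exists (f z0); exists z0 => /=.
exists (inf A); apply/cvgrPdist_lt => e e0.
have [_ [z1 /= zz1 <-] fz1] := inf_adherent e0 iA.
exists z1; split; first exact: num_real.
move=> z z1z; have ge : inf A <= f z.
  by apply: ge_inf => //; exists z => //=; rewrite (le_trans zz1) ?ltW.
have lt : f z < f z1.
  apply: decreasing_lt fD z1z _ => x /andP[z1x _]; apply: fneg.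
  exact: le_trans z1x.
by rewrite distrC ger0_norm ?subr_ge0//; lra.
Qed.

Lemma smooth1_reflect f : smooth1 f -> smooth1 (fun z => f (- z)).
Proof.
move=> sf.
have E k : derive1n k (fun z => f (- z)) = (fun z => (-1) ^+ k * derive1n k f (- z)).
  elim: k => [|k IH]; first by apply/funext => z; rewrite !derive1n0 expr0 mul1r.
  apply/funext => z; rewrite derive1nS IH; apply: is_derive1_derive1.
  rewrite exprSr -mulrA mulN1r; apply: is_deriveMl_fun; apply: is_derive_reflect.
  by apply: derivable_is_derive; exact: sf.
move=> k z; rewrite E.
have D := is_derive_reflect (derivable_is_derive (sf k (- z))).
by have [] := is_deriveMl_fun ((-1) ^+ k) D.
Qed.

Lemma end_condition_reflect f : smooth1 f -> end_condition_ninfty f ->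
  end_condition_pinfty (fun z => f (- z)).
Proof.
move=> sf [nolim|[a a0 fa]].
  left => -[l Hl]; apply: nolim; exists l; apply/cvgrPdist_lt => e e0.
  have /cvgrPdist_lt /(_ e e0) [M [_ HM]] := Hl.
  exists (- M); split; first exact: num_real.
  by move=> z zM; have := HM (- z); rewrite opprK; apply; rewrite ltrNr.
right; exists (- a); first by rewrite oppr_gt0.
move=> z az; have D := smooth1_is_derive (- z) sf.
rewrite (is_derive1_derive1 (is_derive_reflect D)) mulrN -mulNr; apply: fa.
by rewrite ltrNl.
Qed.

Lemma decreasing_not_local_max f (a c : R) : (forall z : R, is_derive z 1 f (derive1 f z)) ->
  a < c -> (forall z, a <= z < c -> derive1 f z < 0) -> ~ weak_local_max f c.
Proof.
move=> fD ac fneg H.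
have {}H : \forall z \near c^'-, f z <= f c by rewrite near_withinE; apply: filterS H.
suff : \forall z \near c^'-, False by move=> /filter_ex[].
near=> z; have zc : z < c by near: z; exact: nbhs_left_lt.
have az : a < z by near: z; exact: nbhs_left_gt.
have : f z <= f c by near: z.
rewrite leNgt => /negP; apply; apply: (decreasing_lt fD zc) => x /andP[zx xc].
by rewrite fneg// xc (le_trans (ltW az)).
Unshelve. all: by end_near. Qed.

End Ends.

(** The sign of [H] is prescribed over an open interval of radii; this carries the weak inequality
    to the axis and the boundary. *)
Lemma ge0_closure (R : realType) (f : R -> R) (rho : R) : 0 < rho ->
  {within `[0, rho], continuous f} -> (forall y, 0 < y < rho -> 0 < f y) ->
  forall y, 0 <= y <= rho -> 0 <= f y.
Proof.
move=> rho0 /continuous_within_itvP-/(_ rho0)[_ f0 fr] fpos y /andP[y0 yr].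
rewrite leNgt; apply/negP => fy.
move: y0; rewrite le_eqVlt => /orP[/eqP y0|y0].
  move: f0 => /cvgrPdist_lt /(_ (- f 0)); rewrite oppr_gt0 {1}y0 => /(_ fy) H.
  suff : \forall x \near (0 : R)^'+, False by move=> /filter_ex[].
  near=> x; have x0 : 0 < x by near: x; exact: nbhs_right_gt.
  have xr : x < rho by near: x; exact: nbhs_right_lt.
  have : `|f 0 - f x| < - f 0 by near: x.
  have := fpos x; rewrite x0 xr => /(_ isT).
  by rewrite ltr_norml; lra.
move: yr; rewrite le_eqVlt => /orP[/eqP yr|yr]; last first.
  by have := fpos y; rewrite y0 yr => /(_ isT); rewrite ltNge ltW.
move: fr => /cvgrPdist_lt /(_ (- f rho)); rewrite oppr_gt0 -{1}yr => /(_ fy) H.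
suff : \forall x \near rho^'-, False by move=> /filter_ex[].
near=> x; have x0 : 0 < x by near: x; exact: nbhs_left_gt.
have xr : x < rho by near: x; exact: nbhs_left_lt.
have : `|f rho - f x| < - f rho by near: x.
have := fpos x; rewrite x0 xr => /(_ isT).
by rewrite ltr_norml; lra.
Unshelve. all: by end_near. Qed.

(** * The limit disk in cases (a) and (b) *)

Section Limit.
Variables (R : realType) (n : nat) (wS : R -> R) (z1 z2 : \bar R).
Variables (r0 : R) (w0 r : R -> R) (w : R -> R -> R).
Hypothesis n_ge2 : (2 <= n)%N.
Hypothesis wS_smooth : smooth1 wS.
Hypothesis wS_neq0 : ~ (exists z, wS z = 0).
Hypothesis init : initial_hypersurface n wS z1 z2 r0 w0.
Hypothesis sol : global_solution n wS r0 w0 r w.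

Lemma wS_derive (z : R) : is_derive z 1 wS (derive1 wS z).
Proof. exact: smooth1_is_derive. Qed.

Lemma exists_enorm (y : R) : 0 <= y -> exists x : 'rV[R]_n, enorm x = y.
Proof.
move=> y0; have n0 : (0 < n)%N by exact: leq_trans n_ge2.
exists (y *: dirvec R (Ordinal n0)); rewrite enormZ ger0_norm//.
have := enorm_line 0 (Ordinal n0) (1 : R).
rewrite scale1r addr0 enorm0 mxE mulr0 mul0r !expr0n expr1n !add0r sqrtr1 => ->.
by rewrite mulr1.
Qed.

(** At the initial boundary height [wS] equals [r0 > 0], and a nonpositive value elsewhere would
    produce a zero. *)
Lemma wS_gt0 z : 0 < wS z.
Proof.
have wc : continuous wS by move=> x; exact: is_derive1_continuous (wS_derive x).
have adm := init_admissible init.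
have wb : 0 < wS (w0 r0) by rewrite -(adm_boundary adm) (adm_r0 adm).
rewrite ltNge; apply/negP => wz; apply: wS_neq0.
have mM : Num.min z (w0 r0) <= Num.max z (w0 r0) by rewrite le_max ge_min lexx.
have [||c _ E] := @IVT R wS _ _ 0 mM.
- exact: continuous_subspaceT.
- by case: (leP z (w0 r0)) => _; rewrite ?ge_min ?le_max ?wz ?(ltW wb) ?orbT.
- by exists c.
Qed.

(** [sol_init] concerns the open interval only; both boundary values are left limits of the same
    function. *)
Lemma initial_boundary_height : w (r 0) 0 = w0 r0.
Proof.
have adm := init_admissible init; have r00 := adm_r0 adm.
have := within_slice (lexx 0) (let: And4 h _ _ _ := sol_cont sol in h).
rewrite (sol_r_init sol) => /continuous_within_itvP-/(_ r00)[_ _ wl].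
have w0c : {within `[0, r0], continuous w0}.
  by apply: continuous_subspaceW (adm_cont adm) => y /=; rewrite in_itv.
have [_ _ w0l] := (continuous_within_itvP _ r00).1 w0c.
apply: (cvg_unique _ wl) => //; apply: cvg_trans w0l.
apply: near_eq_cvg; near=> y; rewrite (sol_init sol)//.
by apply/andP; split; near: y; [exact: nbhs_left_gt|exact: nbhs_left_lt].
Unshelve. all: by end_near. Qed.

Lemma initial_boundary_in : (z1 < (w0 r0)%:E < z2)%E.
Proof.
have r00 := adm_r0 (init_admissible init).
have [x xr] := exists_enorm (ltW r00).
have px : rot_graph w0 r0 (x, w0 r0) by exists x; rewrite /= xr.
by have [_] := init_contained init px.
Qed.

(** The factor [s] is 1 in case (a) and -1 in case (b). *)
Lemma initial_velocity_sign (s : R) :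
  (forall x : 'rV[R]_n, 0 < enorm x < r0 -> s * mean_curvature w0 x < 0) ->
  forall y, 0 <= y <= r 0 -> 0 <= s * Dt w y 0.
Proof.
move=> Hx; have adm := init_admissible init; have r00 := adm_r0 adm.
rewrite (sol_r_init sol); apply: (@ge0_closure _ (fun y => s * Dt w y 0)) => //.
  have := within_slice (lexx 0) (let: And4 _ _ _ h := sol_cont sol in h).
  by rewrite (sol_r_init sol) => vc x; apply: cvgMr; exact: vc.
move=> y yr; have [x xy] : exists x : 'rV[R]_n, enorm x = y.
  by apply: exists_enorm; case/andP: yr => /ltW.
have := Hx x; rewrite xy => /(_ yr).
rewrite (initial_velocity (adm_C2 adm) sol) ?xy//.
rewrite mulrA pmulr_llt0 ?mulrN ?oppr_lt0// invr_gt0 sqrtr_gt0.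
by rewrite ltr_pwDl// sqr_ge0.
Qed.

Let m_gt0 : 0 < n%:R - 1 :> R.
Proof. by rewrite subr_gt0 ltr1n. Qed.

Lemma limit_upward : end_condition_pinfty wS -> condition_a n wS z1 z2 r0 w0 ->
  exists2 c, w0 r0 < c & [/\ derive1 wS c = 0,
    forall z, w0 r0 <= z < c -> derive1 wS z < 0 &
    converges_to (flow_at n r w) (disk n wS c)].
Proof.
move=> endp [Hneg [alpha [_ ahigh] aw]].
(* A critical boundary height would support a flat disk of the region above the highest one. *)
have crit0 : derive1 wS (w0 r0) != 0.
  apply/eqP => E; have := ahigh _ (conj initial_boundary_in E).
  by rewrite leNgt aw.
have v_init y : 0 <= y <= r 0 -> 0 <= Dt w y 0.
  move=> yr; rewrite -[Dt w y 0]mul1r; apply: initial_velocity_sign => //.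
  by move=> x xr; rewrite mul1r Hneg.
have := upward_convergence m_gt0 (global_solution_profile wS_smooth sol) v_init.
rewrite initial_boundary_height => /(_ crit0) [].
  by move=> z0; apply: not_decreasing_to_pinfty => //; exact: wS_gt0.
move=> c bc [cc cneg lim]; exists c => //; split => //.
apply: converges_to_disk => //; first exact: wS_gt0.
by move=> t; exact: (sol_r_gt0 sol).
Qed.

Lemma limit_downward : end_condition_ninfty wS -> condition_b n wS z1 z2 r0 w0 ->
  exists2 c, c < w0 r0 & [/\ derive1 wS c = 0,
    forall z, c < z <= w0 r0 -> 0 < derive1 wS z &
    converges_to (flow_at n r w) (disk n wS c)].
Proof.
move=> endn [Hpos [beta [_ blow] bw]].
have crit0 : - derive1 wS (- - w0 r0) != 0.
  rewrite opprK oppr_eq0; apply/eqP => E.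
  by have := blow _ (conj initial_boundary_in E); rewrite leNgt bw.
have v_init y : 0 <= y <= r 0 -> 0 <= - Dt w y 0.
  move=> yr; rewrite -mulN1r; apply: initial_velocity_sign => //.
  by move=> x xr; rewrite mulN1r oppr_lt0 Hpos.
have F := profile_flow_reflection (global_solution_profile wS_smooth sol).
have := upward_convergence m_gt0 F v_init.
rewrite initial_boundary_height => /(_ crit0) [].
  move=> z0 H; have sR := smooth1_reflect wS_smooth.
  apply: (@not_decreasing_to_pinfty _ _ z0 sR (fun z => wS_gt0 (- z))).
    exact: end_condition_reflect.
  move=> z zz; rewrite (is_derive1_derive1 (is_derive_reflect (wS_derive (- z)))).
  exact: H.
move=> c bc [cc cneg lim]; exists (- c); first by rewrite ltrNl.
split.
- by apply/eqP; rewrite -oppr_eq0 cc.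
- move=> z /andP[cz zb]; rewrite -oppr_lt0 -[z]opprK; apply: cneg.
  by rewrite lerN2 zb ltrNl.
- apply: converges_to_disk; first exact: wS_gt0.
    by move=> t; exact: (sol_r_gt0 sol).
  move=> e e0; have [T T0 HT] := lim e e0; exists T => // t Tt.
  have [rt wt] := HT t Tt; split => // y yr.
  by rewrite -normrN opprD opprK; exact: wt.
Qed.

Lemma not_local_max_above (a c : R) : a < c ->
  (forall z, a <= z < c -> derive1 wS z < 0) -> ~ weak_local_max wS c.
Proof. exact: decreasing_not_local_max wS_derive. Qed.

Lemma not_local_max_below (a c : R) : c < a ->
  (forall z, c < z <= a -> 0 < derive1 wS z) -> ~ weak_local_max wS c.
Proof.
move=> ca pos cmax.
have D (z : R) := is_derive_reflect (wS_derive (- z)).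
have E (z : R) := is_derive1_derive1 (D z).
apply: (@decreasing_not_local_max _ (fun z => wS (- z)) (- a) (- c)).
- by move=> z; rewrite E; exact: D.
- by rewrite ltrN2.
- move=> z /andP[az zc]; rewrite E oppr_lt0; apply: pos.
  by rewrite ltrNr zc lerNl.
- have /nbhs_ballP[e e0 H] := cmax; apply/nbhs_ballP; exists e => // z /= cz.
  rewrite opprK; apply: H; rewrite /ball/= opprK -normrN opprD.
  exact: cz.
Qed.

(** Axis points turn inclusions between regions into inclusions between intervals of heights. *)
Lemma theta_axis (a b : \bar R) (z : R) : (a < z%:E < b)%E -> Theta n wS a b (0, z).
Proof. by move=> zab; split => //=; rewrite enorm0 wS_gt0. Qed.

End Limit.

Theorem theorem2p8 (R : realType) (n : nat) (hn : (2 <= n)%N)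
  (wS : R -> R) (wS_smooth : smooth1 wS)
  (CS : R) (CS_ge0 : 0 <= CS)
  (graph_condition : forall z, CS < dot2 (nuSigma wS z) (e1 R))
  (wS_neq0 : ~ (exists z, wS z = 0))
  (end_p : end_condition_pinfty wS) (end_n : end_condition_ninfty wS)
  (z1 z2 : \bar R) (belly : belly_region wS z1 z2) :
  (forall (r0 : R) (w0 : R -> R) (r : R -> R) (w : R -> R -> R),
     initial_hypersurface n wS z1 z2 r0 w0 ->
     condition_a n wS z1 z2 r0 w0 \/ condition_b n wS z1 z2 r0 w0 ->
     global_solution n wS r0 w0 r w ->
     exists zs : R,
       [/\ derive1 wS zs = 0,
           converges_to (flow_at n r w) (disk n wS zs) &
           made_of_necks_and_bellies wS ->
             weak_local_min wS zs /\
             exists a b : \bar R, neck_region wS a b /\ (a < zs%:E < b)%E]) /\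
  (forall zmin zmax : R, zmin < zmax ->
     maximal_belly_region n wS zmin%:E zmax%:E ->
     Theta n wS z1 z2 `<=` Theta n wS zmin%:E zmax%:E ->
     forall (r0 : R) (w0 : R -> R) (r : R -> R) (w : R -> R -> R),
       initial_hypersurface n wS z1 z2 r0 w0 ->
       global_solution n wS r0 w0 r w ->
       (condition_a n wS z1 z2 r0 w0 ->
          unique_limit_disk n wS (flow_at n r w) zmax) /\
       (condition_b n wS z1 z2 r0 w0 ->
          unique_limit_disk n wS (flow_at n r w) zmin)).
Proof.
split=> [r0 w0 r w init ab sol|zmin zmax zlt [bel maxi] sub r0 w0 r w init sol].
  have [c [c_crit lim not_max]] : exists c, [/\ derive1 wS c = 0,
      converges_to (flow_at n r w) (disk n wS c) & ~ weak_local_max wS c].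
    case: ab => [ca|cb].
      have [c bc [cc cneg lim]] := limit_upward hn wS_smooth wS_neq0 init sol end_p ca.
      by exists c; split => //; exact: (not_local_max_above wS_smooth bc cneg).
    have [c cb' [cc cpos lim]] := limit_downward hn wS_smooth wS_neq0 init sol end_n cb.
    by exists c; split => //; exact: (not_local_max_below wS_smooth cb' cpos).
  exists c; split => // necks; have [a [b [cab [neck|bell]]]] := necks c c_crit.
    by split; [exact: neck|exists a, b].
  by exfalso; apply: not_max; exact: bell.
have Rpos t : 0 <= t -> 0 < r t by exact: (sol_r_gt0 sol).
have bin := initial_boundary_in hn init.
have [_] := sub _ (theta_axis wS_smooth wS_neq0 init bin).
rewrite /= !lte_fin => /andP[zb bz].
split=> [ca|cb].
  have [c bc [cc cneg lim]] := limit_upward hn wS_smooth wS_neq0 init sol end_p ca.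
  suff cE : c = zmax.
    subst c; split => // z' _; exact: limit_disk_unique lim.
  have notlt : ~~ (c < zmax).
    apply/negP => cz; apply: (not_local_max_above wS_smooth bc cneg).
    by apply: bel => //; rewrite !lte_fin cz (lt_trans zb bc).
  apply/eqP; rewrite eq_le (leNgt zmax) notlt andbT leNgt; apply/negP => zc.
  (* If [zmax < c], then ([zmin], [c]) gives a larger belly region: there are no critical heights in
     [[w0 r0], [c]), and those below [w0 r0] lie in the old region. The axis point at height [zmax]
     shows that the inclusion is proper. *)
  apply: (maxi zmin%:E c%:E).
    move=> z; rewrite !lte_fin => /andP[zz zc'] zcrit; apply: bel => //.
    rewrite !lte_fin zz/= (lt_trans _ bz)// ltNge; apply/negP => bz'.
    by have := cneg z; rewrite bz' zc' zcrit ltxx => /(_ isT).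
  split=> [p [p1 /andP[p2 p3]]|H].
    by split => //; rewrite p2 (lt_trans p3)// lte_fin.
  have := H (0, zmax) (theta_axis wS_smooth wS_neq0 init _).
  by rewrite !lte_fin zlt zc => /(_ isT) [_]; rewrite /= !lte_fin ltxx andbF.
have [c cb' [cc cpos lim]] := limit_downward hn wS_smooth wS_neq0 init sol end_n cb.
suff cE : c = zmin.
  subst c; split => // z' _; exact: limit_disk_unique lim.
have notlt : ~~ (zmin < c).
  apply/negP => cz; apply: (not_local_max_below wS_smooth cb' cpos).
  by apply: bel => //; rewrite !lte_fin cz (lt_trans cb' bz).
apply/eqP; rewrite eq_le leNgt notlt/= leNgt; apply/negP => zc.
apply: (maxi c%:E zmax%:E).
  move=> z; rewrite !lte_fin => /andP[zc' zz] zcrit; apply: bel => //.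
  rewrite !lte_fin zz andbT (lt_trans zb)// ltNge; apply/negP => bz'.
  by have := cpos z; rewrite bz' zc' zcrit ltxx => /(_ isT).
split=> [p [p1 /andP[p2 p3]]|H].
  by split => //; rewrite p3 andbT (lt_trans _ p2)// lte_fin.
have := H (0, zmin) (theta_axis wS_smooth wS_neq0 init _).
by rewrite !lte_fin zlt zc => /(_ isT) [_]; rewrite /= !lte_fin ltxx.
Qed.
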